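(* Let $\mathbb{G}$ be a Carnot group with Carnot--Carath\'eodory distance $d$, and let $f\colon\mathbb{G}\to\mathbb{R}$ be Lipschitz with respect to $d$. Then the set of irregular points of $f$ is $\sigma$-porous.
   Context: Carnot group: a connected, simply connected finite dimensional Lie group $\mathbb{G}$ whose Lie algebra $\mathfrak{g}$ (left invariant vector fields) is stratified of step $s$: $\mathfrak{g}=V_1\oplus\cdots\oplus V_s$ with $[V_1,V_i]=V_{i+1}$ for $1\le i\le s-1$ and $[V_1,V_s]=\{0\}$, where $[V_1,V_i]=\mathrm{span}\{[a,b]:a\in V_1,b\in V_i\}$. Fix a basis $X_1,\dots,X_n$ of $\mathfrak{g}$ adapted to the stratification (a union of consecutive bases of $V_1,\dots,V_s$), so $X_1,\dots,X_m$ is a basis of $V_1$, where $m=\dim V_1$. The map $\exp\colon\mathfrak{g}\to\mathbb{G}$ is the exponential map (a diffeomorphism); $\mathbb{G}$ is identified with $\mathbb{R}^n$ via $\exp(x_1X_1+\cdots+x_nX_n)\leftrightarrow(x_1,\dots,x_n)$, so the identity is $0$. Dilations: $\delta_t(x_1,\dots,x_n)=(t^{d_1}x_1,\dots,t^{d_n}x_n)$, where $d_j=i$ if $X_j\in V_i$; the formula is used for all real $t$. Carnot--Carath\'eodory distance: an absolutely continuous curve $\gamma\colon[a,b]\to\mathbb{G}$ is horizontal if there are $u_1,\dots,u_m\in L^1[a,b]$ with $\gamma'(t)=\sum_{j=1}^m u_j(t)X_j(\gamma(t))$ for almost every $t$; its length is $L(\gamma)=\int_a^b|u(t)|\,dt$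 with $|\cdot|$ the Euclidean norm on $\mathbb{R}^m$. Then $d(x,y)$ is the infimum of $L(\gamma)$ over horizontal curves $\gamma\colon[0,1]\to\mathbb{G}$ joining $x$ to $y$; write $d(x)=d(x,0)$. Directional derivative: for $f\colon\mathbb{G}\to\mathbb{R}$, $x\in\mathbb{G}$, $E\in V_1$, $Ef(x)=\lim_{t\to0}\frac{f(x\exp(tE))-f(x)}{t}$, when this limit exists. Regular point: $x\in\mathbb{G}$ is a regular point of $f\colon\mathbb{G}\to\mathbb{R}$ if for every $E\in V_1$ for which $Ef(x)$ exists, \[\lim_{t\to0}\frac{f(x\delta_t(u)\exp(tE))-f(x\delta_t(u))}{t}=Ef(x)\] uniformly for $u\in\mathbb{G}$ with $d(u)\le1$. A point is irregular if it is not regular. Porosity: in a metric space $(M,\rho)$, a set $E\subset M$ is porous at $a\in M$ with constant $\lambda>0$ if there is a sequence $x_n\to a$ with $x_n\neq a$ and $B(x_n,\lambda\rho(a,x_n))\cap E=\varnothing$ for all $n$ (open balls). $E$ is porous if there is a single $\lambda>0$ such that $E$ is porous at every $a\in E$ with constant $\lambda$. A set is $\sigma$-porous if it is a countable union of porous sets. Porosity in $\mathbb{G}$ is with respect to $d$. *)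

(* Defs.v *)
From HB Require Import structures.
From mathcomp Require Import all_boot all_order all_algebra.
From mathcomp Require Import all_classical all_reals all_analysis.

Set Implicit Arguments.
Unset Strict Implicit.
Unset Printing Implicit Defensive.

Import Order.TTheory GRing.Theory Num.Theory.
Import numFieldNormedType.Exports.

Local Open Scope classical_set_scope.
Local Open Scope ring_scope.

(* Continuous directional derivatives up to order k; on finite dimensional
   spaces this is the class C^k. *)
Fixpoint Ck (R : realType) (V W : normedModType R) (k : nat) (g : V -> W)
    : Prop :=
  if k is k'.+1
  then (forall x v, derivable g x v) /\ (forall v, Ck k' ('D_v g))
  else continuous g.

Definition smooth (R : realType) (V W : normedModType R) (g : V -> W) : Prop :=
  forall k, Ck k g.

Definition lin_span (R : realType) (V : lmodType R) (A : set V) : set V :=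
  [set w | exists (N : nat) (c : 'I_N -> R) (v : 'I_N -> V),
     (forall k, A (v k)) /\ w = \sum_(k < N) c k *: v k].

(* The bracket with [X, Y] g = X (Y g) - Y (X g), in coordinates. *)
Definition vf_bracket (R : realType) (n : nat)
    (X Y : 'rV[R]_n -> 'rV[R]_n) : 'rV[R]_n -> 'rV[R]_n :=
  fun x => 'D_(X x) Y x - 'D_(Y x) X x.

(* The left invariant vector field whose value at the identity 0 is e_j. *)
Definition basis_field (R : realType) (n : nat)
    (mul : 'rV[R]_n -> 'rV[R]_n -> 'rV[R]_n) (j : 'I_n)
    : 'rV[R]_n -> 'rV[R]_n :=
  fun x => 'D_(delta_mx 0 j) (mul x) 0.

(* V_i, for the weights deg (deg j = i means that X_j belongs to V_i). *)
Definition stratum (R : realType) (n : nat)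
    (mul : 'rV[R]_n -> 'rV[R]_n -> 'rV[R]_n) (deg : 'I_n -> nat) (i : nat)
    : set ('rV[R]_n -> 'rV[R]_n) :=
  lin_span [set basis_field mul j | j in [set j | deg j = i]].

Definition bracket_span (R : realType) (n : nat)
    (A B : set ('rV[R]_n -> 'rV[R]_n)) : set ('rV[R]_n -> 'rV[R]_n) :=
  lin_span [set Z | exists X Y, [/\ A X, B Y & Z = vf_bracket X Y]].

(* A Carnot group in exponential coordinates with respect to an adapted basis
   X_1, ..., X_n (indices start at 0 below): a Lie group structure on R^n with
   identity 0.  The field [cg_exp] says that t |-> t a is the integral curve of
   a_1 X_1 + ... + a_n X_n through 0, that is, exp (a_1 X_1 + ... + a_n X_n) is
   the point a.  As X_j(0) = e_j, the X_j form a basis of the Lie algebra, which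
   is hence the direct sum of the strata V_1, ..., V_s. *)
Record carnot_group (R : realType) (n : nat) := CarnotGroup {
  cg_mul : 'rV[R]_n -> 'rV[R]_n -> 'rV[R]_n;
  cg_inv : 'rV[R]_n -> 'rV[R]_n;
  cg_step : nat;
  cg_deg : 'I_n -> nat;
  cg_mul_smooth :
    smooth (fun p : 'rV[R]_n * 'rV[R]_n => cg_mul p.1 p.2);
  cg_inv_smooth : smooth cg_inv;
  cg_mulA : associative cg_mul;
  cg_mul0l : left_id 0 cg_mul;
  cg_mul0r : right_id 0 cg_mul;
  cg_mulVl : left_inverse 0 cg_inv cg_mul;
  cg_mulVr : right_inverse 0 cg_inv cg_mul;
  cg_exp : forall (a : 'rV[R]_n) (t : R),
    is_derive t (1 : R) (fun r : R => r *: a)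
      (\sum_(j < n) a 0 j *: basis_field cg_mul j (t *: a));
  cg_step_gt0 : (0 < cg_step)%N;
  cg_deg_bound : forall j, (0 < cg_deg j <= cg_step)%N;
  cg_deg_homo : forall j k : 'I_n, (j <= k)%N -> (cg_deg j <= cg_deg k)%N;
  cg_stratS : forall i, (0 < i < cg_step)%N ->
    bracket_span (stratum cg_mul cg_deg 1) (stratum cg_mul cg_deg i) =
    stratum cg_mul cg_deg i.+1;
  cg_strat_last :
    bracket_span (stratum cg_mul cg_deg 1) (stratum cg_mul cg_deg cg_step) =
    [set 0]
}.

Definition cg_field (R : realType) (n : nat) (G : carnot_group R n) (j : 'I_n) :
    'rV[R]_n -> 'rV[R]_n :=
  basis_field (cg_mul G) j.

Definition dilation (R : realType) (n : nat) (G : carnot_group R n) (t : R)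
    (x : 'rV[R]_n) : 'rV[R]_n :=
  \row_j (t ^+ cg_deg G j * x 0 j).

Definition abs_continuous (R : realType) (V : normedModType R) (a b : R)
    (gamma : R -> V) : Prop :=
  forall eps : R, 0 < eps -> exists2 delta : R, 0 < delta &
    forall (N : nat) (l r : 'I_N -> R),
      (forall k, a <= l k /\ l k <= r k /\ r k <= b) ->
      trivIset setT (fun k => [set` `]l k, r k[]) ->
      \sum_(k < N) (r k - l k) < delta ->
      \sum_(k < N) `|gamma (r k) - gamma (l k)| < eps.

(* gamma is horizontal on [a, b], with controls u.  Only the components u_j with
   deg j = 1 matter, that is, u_1, ..., u_m. *)
Definition horizontal (R : realType) (n : nat) (G : carnot_group R n) (a b : R)
    (gamma : R -> 'rV[R]_n) (u : 'I_n -> R -> R) : Prop :=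
  [/\ abs_continuous a b gamma,
      forall j, cg_deg G j = 1%N ->
        (@lebesgue_measure R).-integrable [set` `[a, b]] (EFin \o u j) &
      {ae @lebesgue_measure R, forall t, t \in `]a, b[ ->
        is_derive t (1 : R) gamma
          (\sum_(j < n | cg_deg G j == 1%N) u j t *: cg_field G j (gamma t))}].

Definition hlength (R : realType) (n : nat) (G : carnot_group R n) (a b : R)
    (u : 'I_n -> R -> R) : R :=
  (\int[@lebesgue_measure R]_(t in [set` `[a, b]])
     Num.sqrt (\sum_(j < n | cg_deg G j == 1%N) u j t ^+ 2))%R.

(* The set of lengths is nonempty by Chow's theorem, so that this real infimum
   never takes its default value. *)
Definition cc_dist (R : realType) (n : nat) (G : carnot_group R n)
    (x y : 'rV[R]_n) : R :=
  inf [set L | exists gamma u, [/\ horizontal G 0 1 gamma u,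
     gamma 0 = x, gamma 1 = y & L = hlength G 0 1 u]].

(* The coordinate vectors E that represent the elements of V_1; the point
   exp (t E) is then t *: E. *)
Definition in_V1 (R : realType) (n : nat) (G : carnot_group R n)
    (E : 'rV[R]_n) : Prop :=
  forall j, cg_deg G j <> 1%N -> E 0 j = 0.

Definition diff_quot (R : realType) (n : nat) (G : carnot_group R n)
    (f : 'rV[R]_n -> R) (E x : 'rV[R]_n) (t : R) : R :=
  (f (cg_mul G x (t *: E)) - f x) / t.

Definition has_dir_deriv (R : realType) (n : nat) (G : carnot_group R n)
    (f : 'rV[R]_n -> R) (E x : 'rV[R]_n) (l : R) : Prop :=
  diff_quot G f E x t @[t --> (0 : R)^'] --> l.

Definition regular_point (R : realType) (n : nat) (G : carnot_group R n)
    (f : 'rV[R]_n -> R) (x : 'rV[R]_n) : Prop :=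
  forall (E : 'rV[R]_n) (l : R), in_V1 G E -> has_dir_deriv G f E x l ->
    {uniform [set u | cc_dist G u 0 <= 1],
      (fun (t : R) (u : 'rV[R]_n) =>
         diff_quot G f E (cg_mul G x (dilation G t u)) t) @ (0 : R)^'
      --> (fun=> l)}.

Definition dist_lipschitz (R : realType) (M : Type) (rho : M -> M -> R)
    (f : M -> R) : Prop :=
  exists L : R, forall x y, `|f x - f y| <= L * rho x y.

Definition porous_at (R : realType) (M : Type) (rho : M -> M -> R) (lam : R)
    (A : set M) (a : M) : Prop :=
  exists z : nat -> M,
    [/\ rho (z k) a @[k --> \oo] --> (0 : R),
        forall k, z k <> a &
        forall k, [set y | rho (z k) y < lam * rho a (z k)] `&` A = set0].

Definition porous (R : realType) (M : Type) (rho : M -> M -> R) (A : set M)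
    : Prop :=
  exists2 lam : R, 0 < lam & forall a, A a -> porous_at rho lam A a.

Definition sigma_porous (R : realType) (M : Type) (rho : M -> M -> R)
    (A : set M) : Prop :=
  exists2 F : nat -> set M,
    (forall k, porous rho (F k)) & A = \bigcup_k F k.

(* Main.v *)
Require Import Defs.
From mathcomp Require Import all_boot all_order all_algebra.
From mathcomp Require Import all_classical all_reals all_analysis.
From mathcomp Require Import ring lra.
From mathcomp Require Import measurable_realfun.

Set Implicit Arguments.
Unset Strict Implicit.
Unset Printing Implicit Defensive.

Import Order.TTheory GRing.Theory Num.Theory.
Import numFieldNormedType.Exports.

Local Open Scope classical_set_scope.
Local Open Scope ring_scope.

(* The point x is irregular when, for some direction E and l = E f (x), there are
   arbitrarily small t and points z = x * delta_t u with d(u) <= 1 at which the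
   increment of f along tE differs from t l by more than a fixed multiple of |t|.
   Replace E, l, that multiple and the scale below which x itself satisfies the
   opposite estimate by rational data; this gives countably many sets.  A point y
   with d(z, y) a small multiple of d(x, z) <= |t| is z * delta_t w with w close
   to 0, and y * tE = (z * tE) * delta_t(E^-1 w E).  As f is Lipschitz, the
   increments of f at y and z along tE differ by little, so y is not in the set
   of x, which is therefore porous.

   Three facts about the group are needed.  Left invariance and homogeneity of d
   rest on delta_t being an automorphism.  This follows from uniqueness for the
   ODE r -> x * (r a) once X_j^k(x) = t^(d_j - d_k) X_j^k(delta_t x) is known; both
   sides solve, along rays, the same Riccati system, whose coefficients are the
   graded structure constants.  Points at small distance from 0 are close to 0
   because |gamma(1) - gamma(0)| is at most the integral of the speed.
   Conversely f(p * delta_t w) - f(p) = o(1) |t| as w -> 0: w is a product of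
   factors s e_j = delta_r(+-e_j) with r^(d_j) = |s| small. *)

(** * Calculus *)

(** A [carnot_group] comes with no formula for its product and no statement that dilations are
    automorphisms. Both facts have to be drawn from the brackets of the strata and from the rays
    being integral curves. The Jacobi identity first spreads [[V_1, V_i] = V_(i+1)] to an inclusion
    of [[V_i, V_j]] in [V_(i+j)], and this grades the structure constants. The Euclidean norm
    mediates between two uses of [d]. The perturbation w is small for [d], but the factor that moves
    z * tE is the conjugate E^-1 w E, whose smallness comes from continuity of the group law, that
    is, in the norm. So small distance must imply small norm, and small norm must imply small
    increments of [f], uniformly in the base point and relative to |t|. The thresholds eps/4 and
    eps/2 leave room for errors eps/16: two of them separate z from y, and a few more come from
    rational approximation. Points joined by no horizontal curve have distance inf of the empty set,
    which is 0. Comparisons of distances therefore carry reachability as a hypothesis, and that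
    degenerate case is settled separately at the very end. *)

Section epsilon_delta.
Context {R : realType}.

Lemma cvg_dnbhs0P (V : normedModType R) (f : R -> V) (l : V) :
  f s @[s --> (0 : R)^'] --> l <->
  (forall e : R, 0 < e -> exists2 d : R, 0 < d &
     forall s, s != 0 -> `|s| < d -> `|f s - l| <= e).
Proof.
split=> [/cvgrPdist_le fl e e0|fl].
  have [d /= d0 dP] := fl e e0; exists d => // s s0 sd.
  by rewrite distrC; apply: dP => //=; rewrite sub0r normrN.
apply/cvgrPdist_le => e e0; have [d d0 dP] := fl e e0.
by exists d => //= s; rewrite /= sub0r normrN distrC => sd s0; apply: dP.
Qed.

Lemma continuous_atP (V W : normedModType R) (f : V -> W) (x : V) :
  {for x, continuous f} <->
  (forall e : R, 0 < e -> exists2 d : R, 0 < d &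
     forall y, `|y - x| < d -> `|f y - f x| <= e).
Proof.
split=> [/cvgrPdist_le fl e e0|fl].
  have /nbhs_ballP[d /= d0 dP] := fl e e0; exists d => // y yd.
  by rewrite distrC; apply: dP => //=; rewrite -ball_normE/= distrC.
apply/cvgrPdist_le => e e0; have [d d0 dP] := fl e e0.
apply/nbhs_ballP; exists d => //= y; rewrite -ball_normE/= distrC => yd.
by rewrite distrC; apply: dP.
Qed.

End epsilon_delta.

Section line.
Context {R : realType} {V : normedModType R}.
Implicit Types (f : V -> R) (x u v : V) (s : R).

Lemma is_derive_line (W : normedModType R) (f : V -> W) x v s :
  derivable f (x + s *: v) v ->
  is_derive s (1 : R) (fun r : R => f (x + r *: v)) ('D_v f (x + s *: v)).
Proof.
have E : (fun h : R => h^-1 *: ((fun r : R => f (x + r *: v)) (h *: (1:R) + s) - f (x + s *: v)))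
       = (fun h : R => h^-1 *: (f (h *: v + (x + s *: v)) - f (x + s *: v))).
  by apply/funext => h /=; rewrite scalerDl -scalerA scale1r addrCA.
by move=> fd; split; rewrite /derivable /derive /= ?E.
Qed.

Lemma is_derive_mulrl (s r : R) : is_derive r (1 : R) (fun q : R => q * s) s.
Proof.
have := @is_deriveZ R R R id s r 1 1 (is_derive_id _ _).
rewrite (_ : (s \*: id) = (fun q : R => q * s)) /GRing.scale /= ?mulr1 //.
by apply/funext => q; rewrite /= /GRing.scale/= mulrC.
Qed.

Lemma line_MVT f x v s : (forall y, derivable f y v) ->
  exists2 th : R, 0 <= th <= 1 &
    f (x + s *: v) - f x = s * 'D_v f (x + (th * s) *: v).
Proof.
move=> fd.
pose g (r : R) := f (x + (r * s) *: v).
have gd (r : R) : is_derive r (1 : R) g (s * 'D_v f (x + (r * s) *: v)).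
  have h1 := is_derive_line (fd (x + (r * s) *: v)).
  rewrite mulrC.
  exact: (@is_derive1_comp R (fun r => f (x + r *: v)) (fun r => r * s) r _ _
    h1 (is_derive_mulrl s r)).
have [|th] := @MVT_segment R g (fun r => s * 'D_v f (x + (r * s) *: v)) 0 1 ler01 (fun r _ => gd r).
  by apply: derivable_within_continuous => r _; case: (gd r).
rewrite in_itv/= => th01; rewrite /g mul1r mul0r scale0r addr0 subr0 mulr1 => ->.
by exists th.
Qed.

(** [Ck] only speaks of directional derivatives, so linearity in the direction must come from their
    continuity: move from [x] along [v], then along [u], use the mean value theorem on each leg, and
    let the intermediate points tend to [x]. *)
Lemma Ck1_is_derive_lin f x u v (c : R) : Ck 1 f ->
  is_derive x (c *: u + v) f (c * 'D_u f x + 'D_v f x).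
Proof.
move=> [fd fc].
suff H : h^-1 *: (f (h *: (c *: u + v) + x) - f x) @[h --> (0:R)^'] -->
    c * 'D_u f x + 'D_v f x.
  split; first by apply/cvg_ex; eexists; exact: H.
  exact: cvg_lim H.
apply/cvg_dnbhs0P => e e0.
pose C : R := `|c| + 1; have C0 : 0 < C by rewrite ltr_wpDl.
have e1 : 0 < e / 2 / C by rewrite !divr_gt0.
have e2 : 0 < e / 2 by rewrite divr_gt0.
have [d1 d10 P1] := (continuous_atP _ _).1 (fc u x) _ e1.
have [d2 d20 P2] := (continuous_atP _ _).1 (fc v x) _ e2.
pose K : R := `|v| + `|c *: u| + 1; have K0 : 0 < K by rewrite ltr_wpDl.
exists (Num.min d1 d2 / K); first by rewrite divr_gt0// lt_min d10.
move=> h h0; rewrite ltr_pdivlMr// lt_min => /andP[hd1 hd2].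
have [t1 /andP[t10 t11] E1] := line_MVT (x + h *: v) (h * c) (fd^~ u).
have [t2 /andP[t20 t21] E2] := line_MVT x h (fd^~ v).
have -> : h *: (c *: u + v) + x = x + h *: v + (h * c) *: u.
  by rewrite addrC scalerDr scalerA (addrC ((h * c) *: u)) addrA.
have -> : h^-1 *: (f (x + h *: v + (h * c) *: u) - f x) =
    c * 'D_u f (x + h *: v + (t1 * (h * c)) *: u) + 'D_v f (x + (t2 * h) *: v).
  have -> : f (x + h *: v + (h * c) *: u) - f x =
     (f (x + h *: v + (h * c) *: u) - f (x + h *: v)) + (f (x + h *: v) - f x).
    by rewrite addrA subrK.
  by rewrite E1 E2 /GRing.scale/= mulrDr !mulrA mulVf// !mul1r.
rewrite opprD addrACA -mulrBr (splitr e).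
apply: le_trans (ler_normD _ _) _; apply: lerD; last first.
  apply: P2; rewrite addrC addKr normrZ normrM (ger0_norm t20).
  apply: le_lt_trans hd2; rewrite /K !mulrDr mulr1 -!addrA.
  apply: (@le_trans _ _ (`|h| * `|v|)).
    by rewrite -mulrA ler_piMl// mulr_ge0.
  by rewrite lerDl addr_ge0// mulr_ge0.
rewrite normrM; apply: (@le_trans _ _ (`|c| * (e / 2 / C))).
  apply: ler_wpM2l => //; apply: P1.
  rewrite -(addrA x) (addrC x) addrK; apply: le_lt_trans hd1.
  apply: le_trans (ler_normD _ _) _.
  rewrite /K !mulrDr mulr1 !normrZ ?normrM (ger0_norm t10) -addrA lerD2l.
  rewrite (@le_trans _ _ (`|h| * (`|c| * `|u|)))//; last by rewrite lerDl.
  by rewrite mulrA -!mulrA ler_piMl// !mulr_ge0.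
rewrite mulrCA ler_piMr ?(ltW e2)//.
by rewrite ler_pdivrMr// mul1r lerDl.
Qed.

(** The second difference of [f] over the parallelogram with sides [s *: u] and [s *: v] is
    symmetric in [u] and [v]. Divided by [s ^+ 2] it tends to either iterated derivative, by two
    applications of the mean value theorem. *)
Lemma Ck2_schwarz f x u v : Ck 2 f -> 'D_u ('D_v f) x = 'D_v ('D_u f) x.
Proof.
move=> [fd f2].
have mixed (u' v' : V) (e : R) : 0 < e -> exists2 d : R, 0 < d &
    forall s, s != 0 -> `|s| < d ->
    `|(f (x + s *: u' + s *: v') - f (x + s *: u') - (f (x + s *: v') - f x))
       / s ^+ 2 - 'D_u' ('D_v' f) x| <= e.
  move: u' v' => {}u {}v e0; have [d d0 P] := (continuous_atP _ _).1 ((f2 v).2 u x) _ e0.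
  pose K : R := `|v| + `|u| + 1; have K0 : 0 < K by rewrite ltr_wpDl.
  exists (d / K); first exact: divr_gt0.
  move=> s s0; rewrite ltr_pdivlMr// => sd.
  pose g y := f (s *: u + y) - f y.
  have gd y : is_derive y v g ('D_v f (s *: u + y) - 'D_v f y).
    apply: is_deriveB; last exact/derivableP/fd.
    have E : (fun h : R => h^-1 *: (f (s *: u + (h *: v + y)) - f (s *: u + y)))
           = (fun h : R => h^-1 *: (f (h *: v + (s *: u + y)) - f (s *: u + y))).
      by apply/funext => h /=; rewrite addrCA.
    by split; rewrite /derivable /derive/= ?E//; exact: fd.
  have [t1 /andP[t10 t11]] := line_MVT x s (fun y => @ex_derive _ _ _ _ _ _ _ (gd y)).
  rewrite (@derive_val _ _ _ _ _ _ _ (gd _)) => E1.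
  have [t2 /andP[t20 t21]] := line_MVT (x + (t1 * s) *: v) s ((f2 v).1^~ u).
  rewrite (addrC _ (s *: u)) => E2.
  have -> : f (x + s *: u + s *: v) - f (x + s *: u) - (f (x + s *: v) - f x) =
      s * (s * 'D_u ('D_v f) (x + (t1 * s) *: v + (t2 * s) *: u)).
    rewrite -E2 -E1 /g opprB addrACA [in RHS]opprB !addrA.
    rewrite (addrC (s *: u) x) [in RHS]addrAC.
    by ring.
  rewrite mulrA -expr2 mulrAC divff ?expf_neq0// mul1r; apply: P.
  rewrite -(addrA x) (addrC x) addrK; apply: le_lt_trans sd.
  apply: le_trans (ler_normD _ _) _.
  rewrite !normrZ ?normrM (ger0_norm t10) (ger0_norm t20) /K mulrDr mulr1.
  rewrite mulrDr -[leLHS]addr0; apply: lerD => //.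
  by apply: lerD; rewrite ler_wpM2r// ler_piMl.
move: (mixed u v) (mixed v u) => {mixed}.
move: ('D_u ('D_v f) x) ('D_v ('D_u f) x) => a b M1 M2 {fd f2}.
apply/eqP; rewrite -subr_eq0 -normr_eq0 eq_le normr_ge0 andbT.
apply/ler_addgt0Pr => e e0; rewrite add0r.
have e2 : 0 < e / 2 by rewrite divr_gt0.
have [d1 d10 P1] := M1 _ e2.
have [d2 d20 P2] := M2 _ e2.
pose s : R := Num.min d1 d2 / 2.
have s0 : 0 < s by rewrite divr_gt0// lt_min d10.
have sm : `|s| < Num.min d1 d2.
  by rewrite gtr0_norm// /s ltr_pdivrMr// ltr_pMr ?ltr1n// lt_min d10.
move: sm; rewrite lt_min => /andP[sd1 sd2].
have s0' : s != 0 by rewrite gt_eqF.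
have := P1 s s0' sd1; have := P2 s s0' sd2.
have -> : f (x + s *: v + s *: u) - f (x + s *: v) - (f (x + s *: u) - f x) =
    f (x + s *: u + s *: v) - f (x + s *: u) - (f (x + s *: v) - f x).
  by rewrite (addrAC x); ring.
move: (_ / _) => A h1 h2; rewrite (splitr e) -(subrKA A).
apply: le_trans (ler_normD _ _) _.
by apply: lerD => //; rewrite distrC.
Qed.

End line.

Section smooth_basic.
Context {R : realType}.

Lemma smooth_derive (V W : normedModType R) (g : V -> W) v :
  smooth g -> smooth ('D_v g).
Proof. by move=> sg k; exact: (sg k.+1).2. Qed.

Lemma smooth_continuous (V W : normedModType R) (g : V -> W) :
  smooth g -> continuous g.
Proof. exact: (@^~ 0%N). Qed.

Lemma smooth_derivable (V W : normedModType R) (g : V -> W) x v :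
  smooth g -> derivable g x v.
Proof. by move=> /(_ 1%N)[+ _]. Qed.

Arguments smooth_derivable {V W g} x v.

Lemma derive_coord (V : normedModType R) m (g : V -> 'rV[R]_m) x v j :
  derivable g x v -> ('D_v g x) 0 j = 'D_v (fun y => g y 0 j) x.
Proof. by move=> gd; rewrite derive_mx// mxE. Qed.

Lemma is_derive_coord (V : normedModType R) m (g : V -> 'rV[R]_m) x v j :
  derivable g x v -> is_derive x v (fun y => g y 0 j) (('D_v g x) 0 j).
Proof.
move=> gd; split; last exact: (esym (derive_coord j gd)).
by have /derivable_mxP := gd.
Qed.

Lemma smooth_coord (V : normedModType R) m (g : V -> 'rV[R]_m) j :
  smooth g -> smooth (fun x => g x 0 j).
Proof.
move=> sg k; elim: k g sg => [|k IH] g sg /=.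
  move=> x; apply: (@continuous_comp _ _ _ g (fun M : 'rV[R]_m => M 0 j)).
    exact: smooth_continuous.
  exact: coord_continuous.
split=> [x v|v]; first by have /derivable_mxP := smooth_derivable x v sg.
rewrite (_ : 'D_v _ = (fun x => 'D_v g x 0 j)); first exact/IH/smooth_derive.
by apply/funext => x; rewrite derive_coord//; exact: smooth_derivable.
Qed.

Lemma rV_coord_le m (x : 'rV[R]_m) j : `|x 0 j| <= `|x|.
Proof. by rewrite [leRHS]mx_normrE; exact: (le_bigmax _ _ (0, j)). Qed.

Lemma rV_norm_le m (x : 'rV[R]_m) (K : R) :
  0 <= K -> (forall j, `|x 0 j| <= K) -> `|x| <= K.
Proof.
by move=> K0 h; rewrite [leLHS]mx_normrE; apply: bigmax_le => // -[i j] _; rewrite ord1.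
Qed.

Lemma derive_rV n (f : 'rV[R]_n -> R) x (w : 'rV[R]_n) : Ck 1 f ->
  'D_w f x = \sum_j w 0 j * 'D_(delta_mx 0 j) f x.
Proof.
move=> Cf; rewrite [in LHS](row_sum_delta w).
elim/big_rec2: _ => [|j a b _ <-]; first exact: derive0.
by have [_ ->] := Ck1_is_derive_lin x (delta_mx 0 j) b (w 0 j) Cf.
Qed.

Lemma cvg_sum_ord (T : Type) (F : set_system T) {FF : Filter F} n
    (f : 'I_n -> T -> R) (l : 'I_n -> R) :
  (forall i, f i x @[x --> F] --> l i) ->
  \sum_i f i x @[x --> F] --> \sum_i l i.
Proof.
elim: n f l => [|n IH] f l fl.
  rewrite big_ord0 (_ : (fun _ => _) = cst 0); first exact: cvg_cst.
  by apply/funext => x; rewrite big_ord0.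
rewrite big_ord_recl (_ : (fun _ => _) = (fun x => f ord0 x + \sum_(i < n) f (lift ord0 i) x)).
  by apply: cvgD => //; apply: IH.
by apply/funext => x; rewrite big_ord_recl.
Qed.

Lemma is_derive_continuous (W : normedModType R) (g : R -> W) t w :
  is_derive t (1 : R) g w -> {for t, continuous g}.
Proof.
by move=> [gd _]; apply/differentiable_continuous/derivable1_diffP.
Qed.

Lemma is_derive1_cvg (W : normedModType R) (g : R -> W) t w :
  is_derive t (1 : R) g w <->
  h^-1 *: (g (h + t) - g t) @[h --> (0 : R)^'] --> w.
Proof.
have E : (fun h : R => h^-1 *: ((g \o shift t) (h *: (1 : R)) - g t)) =
    (fun h : R => h^-1 *: (g (h + t) - g t)).
  by apply/funext => h; rewrite /= /GRing.scale/= mulr1.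
split=> [[gd <-]|gw].
  by rewrite /derive -E; exact: gd.
split; first by apply/cvg_ex; exists w; rewrite E.
by rewrite /derive E; exact: cvg_lim gw.
Qed.

(** The mean value theorem on the chord from [g t] to [g (h + t)] writes the increment as the
    derivative along that chord at an intermediate point. Expanding the chord in coordinates leaves
    continuous partial derivatives and the difference quotient of [g]. *)
Lemma is_derive_comp_curve n (f : 'rV[R]_n -> R) (g : R -> 'rV[R]_n) t w :
  Ck 1 f -> is_derive t (1 : R) g w ->
  is_derive t (1 : R) (fun s => f (g s)) ('D_w f (g t)).
Proof.
move=> Cf dg; apply/is_derive1_cvg.
have gc := is_derive_continuous dg.
pose dl (h : R) := g (h + t) - g t.
have /choice[th thP] : forall h : R, exists th : R, 0 <= th <= 1 /\
    f (g (h + t)) - f (g t) = 'D_(dl h) f (g t + th *: dl h).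
  move=> h; have [th th01 E] := line_MVT (g t) 1 (Cf.1^~ (dl h)).
  exists th; split=> //; rewrite -[in RHS](mulr1 th) -[RHS]mul1r -E scale1r.
  by rewrite /dl (addrC (g t)) subrK.
have E (h : R) : h^-1 *: (f (g (h + t)) - f (g t)) =
    \sum_j (h^-1 *: dl h) 0 j * 'D_(delta_mx 0 j) f (g t + th h *: dl h).
  rewrite (thP h).2 derive_rV// scaler_sumr.
  by apply: eq_bigr => j _; rewrite [(h^-1 *: dl h) 0 j]mxE; exact: mulrA.
under eq_fun do rewrite E.
rewrite derive_rV//; apply: cvg_sum_ord => j; apply: cvgM.
  have /is_derive1_cvg dg' := dg.
  apply: (cvg_comp (fun h => h^-1 *: dl h) (fun M : 'rV[R]_n => M 0 j) dg').
  exact: coord_continuous.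
apply: (@cvg_comp _ _ _ (fun h => g t + th h *: dl h) ('D_(delta_mx 0 j) f) _ (nbhs (g t))); last exact: Cf.2.
apply/cvg_dnbhs0P => e e0.
have [d d0 P] := (continuous_atP _ _).1 gc e e0.
exists d => // s s0 sd; rewrite addrC addKr normrZ.
have [/andP[t0 t1] _] := thP s; rewrite ger0_norm//.
apply: (@le_trans _ _ `|dl s|); first exact: ler_piMl.
by apply: P; rewrite addrK.
Qed.

Lemma is_derive_comp_curve_rV n m (f : 'rV[R]_n -> 'rV[R]_m)
    (g : R -> 'rV[R]_n) t w : smooth f -> is_derive t (1 : R) g w ->
  is_derive t (1 : R) (fun s => f (g s)) ('D_w f (g t)).
Proof.
move=> sf dg.
have H j := is_derive_comp_curve (smooth_coord j sf 1%N) dg.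
have D : derivable (fun s => f (g s)) t 1.
  by apply/derivable_mxP => i j; rewrite ord1; case: (H j).
split; first exact: D.
apply/rowP => j.
have [_ Hj] := H j.
exact: (eq_trans (derive_coord j D) (eq_trans Hj
  (esym (derive_coord j (smooth_derivable _ _ sf))))).
Qed.

Lemma derive_rV_sum n m (f : 'rV[R]_n -> 'rV[R]_m) x w : smooth f ->
  'D_w f x = \sum_j w 0 j *: 'D_(delta_mx 0 j) f x.
Proof.
move=> sf; apply/rowP => k.
rewrite (derive_coord k (smooth_derivable _ _ sf)).
rewrite derive_rV; last exact: (smooth_coord k sf).
rewrite summxE; apply: eq_bigr => j _.
by rewrite mxE (derive_coord k (smooth_derivable _ _ sf)).
Qed.

Lemma smooth_schwarz (V : normedModType R) m (f : V -> 'rV[R]_m) x u v :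
  smooth f -> 'D_u ('D_v f) x = 'D_v ('D_u f) x.
Proof.
move=> sf; apply/rowP => j.
have E (w : V) : (fun y => 'D_w f y 0 j) = 'D_w (fun y => f y 0 j).
  apply/funext => y; exact: (derive_coord j (smooth_derivable _ _ sf)).
have F (a b : V) : 'D_a ('D_b f) x 0 j = 'D_a ('D_b (fun y => f y 0 j)) x.
  rewrite -E; apply: derive_coord.
  exact: (smooth_derivable _ _ (smooth_derive _ sf)).
exact: (eq_trans (F u v) (eq_trans (Ck2_schwarz x u v (smooth_coord j sf 2%N))
  (esym (F v u)))).
Qed.

Lemma compact_closed_ball_rV n (r : R) : compact [set x : 'rV[R]_n | `|x| <= r].
Proof.
apply: bounded_closed_compact.
  by exists r; split; rewrite ?num_real// => M /ltW rM x /= /le_trans; apply.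
rewrite (_ : [set _ | _] = (fun x : 'rV[R]_n => `|x|) @^-1` [set y | y <= r])//.
apply: closed_comp; last exact: closed_le.
by move=> x _; exact: norm_continuous.
Qed.

Lemma continuous_bounded_on_ball n (f : 'rV[R]_n -> R) (r : R) : continuous f ->
  exists2 K : R, 0 <= K & forall x, `|x| <= r -> `|f x| <= K.
Proof.
move=> fc; have [r0|r0] := ltP r 0.
  by exists 0 => // x /le_lt_trans/(_ r0); rewrite normr_lt0.
have [|||c _ cP] := @EVT_max_rV R n (fun x => `|f x|) [set x | `|x| <= r].
- by exists 0; rewrite /= normr0.
- exact: compact_closed_ball_rV.
- apply: continuous_subspaceT => x.
  by apply: (@continuous_comp _ _ _ f (fun y => `|y|)); [exact: fc|exact: norm_continuous].
by exists `|f c| => // x xr; apply: cP; rewrite inE.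
Qed.

(** The ball is convex, so the segment from [y] to [x] stays in it, and there the finitely many
    partial derivatives are bounded by compactness. The sum of all these bounds serves every
    coordinate of [f] at once. *)
Lemma smooth_lipschitz_on_ball n m (f : 'rV[R]_n -> 'rV[R]_m) (r : R) :
  smooth f -> exists2 K : R, 0 <= K &
    forall x y, `|x| <= r -> `|y| <= r -> `|f x - f y| <= K * `|x - y|.
Proof.
move=> sf.
have /choice[K KP] : forall p : 'I_m * 'I_n, exists K : R, 0 <= K /\
    forall x, `|x| <= r -> `|'D_(delta_mx 0 p.2) (fun y => f y 0 p.1) x| <= K.
  move=> [i j]; have sij := smooth_derive (delta_mx 0 j) (smooth_coord i sf).
  by have [K K0 KP] := continuous_bounded_on_ball r (smooth_continuous sij); exists K.
exists (\sum_p K p); first by apply: sumr_ge0 => p _; case: (KP p).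
move=> x y xr yr; apply: rV_norm_le => [|i].
  by rewrite mulr_ge0// sumr_ge0// => p _; case: (KP p).
have Ci : Ck 1 (fun y => f y 0 i) by exact: (smooth_coord i sf 1%N).
have [th /andP[t0 t1]] := line_MVT y 1 (Ci.1^~ (x - y)).
rewrite scale1r mul1r mulr1 (addrC y) subrK.
rewrite [(f x - f y) 0 i]mxE [(- f y) 0 i]mxE => ->.
rewrite derive_rV//; apply: (le_trans (ler_norm_sum _ _ _)).
rewrite (bigID (fun p : 'I_m * 'I_n => p.1 == i))/= mulrDl.
rewrite -[leLHS]addr0; apply: lerD; last first.
  by rewrite mulr_ge0// sumr_ge0// => p _; case: (KP p).
rewrite mulr_suml (reindex_onto (fun j : 'I_n => (i, j)) (fun p => p.2))/=; last first.
  by move=> [a b] /= /eqP ->.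
rewrite [leRHS](eq_bigl xpredT); last by move=> j; rewrite !eqxx.
apply: ler_sum => j _; rewrite normrM mulrC; apply: ler_pM => //.
  apply: (KP (i, j)).2 => /=.
  have -> : y + th *: (x - y) = (1 - th) *: y + th *: x.
    by rewrite scalerBr scalerBl scale1r addrA addrAC.
  apply: (le_trans (ler_normD _ _)); rewrite !normrZ ger0_norm ?subr_ge0// ger0_norm//.
  have -> : r = (1 - th) * r + th * r by rewrite mulrBl mul1r subrK.
  by apply: lerD; rewrite ler_wpM2l// subr_ge0.
exact: rV_coord_le.
Qed.

End smooth_basic.

Arguments smooth_derivable {R V W g} x v.

(** * Brackets of vector fields *)

Section brackets.
Context {R : realType} {n : nat}.
Implicit Types (A B Y Z : 'rV[R]_n -> 'rV[R]_n) (x u v w : 'rV[R]_n).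

Lemma derive_dirB Z x u v : smooth Z -> 'D_(u - v) Z x = 'D_u Z x - 'D_v Z x.
Proof.
move=> sZ; rewrite !(derive_rV_sum x _ sZ) -sumrB.
by apply: eq_bigr => j _; rewrite !mxE scalerBl.
Qed.

Lemma derive_dir_sum Z x N (c : 'I_N -> R) (u : 'I_N -> 'rV[R]_n) : smooth Z ->
  'D_(\sum_k c k *: u k) Z x = \sum_k c k *: 'D_(u k) Z x.
Proof.
move=> sZ; rewrite (derive_rV_sum x _ sZ).
under [RHS]eq_bigr do rewrite (derive_rV_sum x _ sZ) scaler_sumr.
rewrite exchange_big/=; apply: eq_bigr => j _.
rewrite summxE scaler_suml; apply: eq_bigr => k _.
by rewrite mxE scalerA.
Qed.

Let along_terms (y a b c d : 'rV[R]_n) j k : c = d ->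
  y 0 j * c 0 k + b 0 k * a 0 j = (a 0 j *: b) 0 k + (y 0 j *: d) 0 k.
Proof. by move=> ->; rewrite !mxE addrC [X in X + _]mulrC. Qed.

(** Product rule for the sum of [Y_j] times the j-th partial derivative of [Z]. In the second order
    term the direction [Y x] is frozen, a form in which Schwarz's theorem can exchange it with
    [v]. *)
Lemma is_derive_along Y Z x v : smooth Y -> smooth Z ->
  is_derive x v (fun y => 'D_(Y y) Z y) ('D_('D_v Y x) Z x + 'D_v ('D_(Y x) Z) x).
Proof.
move=> sY sZ.
have sYj j := smooth_coord j sY.
have sZj j k := smooth_coord k (smooth_derive (delta_mx 0 j) sZ).
have H k : is_derive x v (fun y => ('D_(Y y) Z y) 0 k)
    (\sum_j (Y x 0 j * ('D_v ('D_(delta_mx 0 j) Z) x) 0 k +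
             ('D_(delta_mx 0 j) Z x) 0 k * ('D_v Y x) 0 j)).
  have E : (fun y => ('D_(Y y) Z y) 0 k) =
      \sum_j (fun y => Y y 0 j * ('D_(delta_mx 0 j) Z y) 0 k).
    apply/funext => y; rewrite (derive_rV_sum y (Y y) sZ) fct_sumE summxE.
    by apply: eq_bigr => j _; rewrite mxE.
  rewrite E; apply: is_derive_sum => j.
  have h1 := is_derive_coord j (smooth_derivable x v sY).
  have h2 := is_derive_coord k
    (smooth_derivable x v (smooth_derive (delta_mx 0 j) sZ)).
  exact: is_deriveM h1 h2.
have D : derivable (fun y => 'D_(Y y) Z y) x v.
  by apply/derivable_mxP => i k; rewrite ord1; case: (H k).
split; first exact: D.
apply/rowP => k; rewrite (derive_coord k D); have [_ ->] := H k.
rewrite (smooth_schwarz x v (Y x) sZ).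
have -> := derive_rV_sum x (Y x) (smooth_derive v sZ).
have -> := derive_rV_sum x ('D_v Y x) sZ.
rewrite [RHS]mxE !summxE -big_split/=; apply: eq_bigr => j _.
exact: (along_terms _ _ _ _ _ (smooth_schwarz x v (delta_mx 0 j) sZ)).
Qed.

Lemma derive_bracket A B x v : smooth A -> smooth B ->
  'D_v (vf_bracket A B) x =
  'D_('D_v A x) B x + 'D_v ('D_(A x) B) x
  - ('D_('D_v B x) A x + 'D_v ('D_(B x) A) x).
Proof.
move=> sA sB.
by have [_] := is_deriveB (is_derive_along x v sA sB) (is_derive_along x v sB sA).
Qed.

Let jacobi_terms (l1 l2 r1 r2 r3 r4 p1 p2 p3 p4 p5 p6 a1 a2 b1 b2 y1 y2 : 'rV[R]_n) :
  l1 = p1 - p2 -> l2 = p3 + b1 - (p4 + a1) ->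
  r1 = p1 + y1 - (p5 + b2) -> r2 = p6 - p4 ->
  r3 = p2 + y2 - (p6 + a2) -> r4 = p5 - p3 ->
  b1 = b2 -> y1 = y2 -> a1 = a2 ->
  l1 - l2 = (r1 - r2) - (r3 - r4).
Proof.
move=> -> -> -> -> -> -> -> -> ->; apply/rowP => k; rewrite !mxE; ring.
Qed.

(** After expansion the second derivatives of [Y] cancel, and those of [A] and [B] match on the two
    sides, each time by Schwarz's theorem. The derivation form of the identity is the one suited to
    the induction on strata. *)
Lemma vf_bracket_jacobi A B Y : smooth A -> smooth B -> smooth Y ->
  vf_bracket (vf_bracket A B) Y =
  vf_bracket A (vf_bracket B Y) - vf_bracket B (vf_bracket A Y).
Proof.
move=> sA sB sY; apply/funext => x.
exact: (jacobi_terms (derive_dirB x _ _ sY) (derive_bracket x (Y x) sA sB)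
  (derive_bracket x (A x) sB sY) (derive_dirB x _ _ sA)
  (derive_bracket x (B x) sA sY) (derive_dirB x _ _ sB)
  (smooth_schwarz x (Y x) (A x) sB) (smooth_schwarz x (A x) (B x) sY)
  (smooth_schwarz x (Y x) (B x) sA)).
Qed.

Lemma vf_bracketC A B : vf_bracket A B = - vf_bracket B A.
Proof. by apply/funext => x; rewrite /vf_bracket opprfctE opprB. Qed.

Lemma smoothD A B : smooth A -> smooth B -> smooth (A + B).
Proof.
move=> sA sB k; elim: k A B sA sB => [|k IH] A B sA sB /=.
  by move=> x; apply: continuousD; exact: smooth_continuous.
split=> [x v|v]; first by apply: derivableD; exact: smooth_derivable.
rewrite (_ : 'D_v (A + B) = 'D_v A + 'D_v B); first by apply: IH; exact: smooth_derive.
by apply/funext => x; apply: deriveD; exact: smooth_derivable.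
Qed.

Lemma smoothZ (c : R) A : smooth A -> smooth (c *: A).
Proof.
move=> sA k; elim: k A sA => [|k IH] A sA /=.
  by move=> x; apply: continuousZr; exact: smooth_continuous.
split=> [x v|v]; first by apply: derivableZ; exact: smooth_derivable.
rewrite (_ : 'D_v (c *: A) = c *: 'D_v A); first by apply: IH; exact: smooth_derive.
by apply/funext => x; apply: deriveZ; exact: smooth_derivable.
Qed.

Lemma smooth0 : smooth (0 : 'rV[R]_n -> 'rV[R]_n).
Proof.
move=> k; elim: k => [|k IH] /=; first exact: cst_continuous.
split=> [x v|v]; first exact: derivable_cst.
rewrite (_ : 'D_v _ = 0)//.
by apply/funext => x; exact: derive_cst.
Qed.

Lemma smooth_lin_comb (N : nat) (c : 'I_N -> R) (A : 'I_N -> 'rV[R]_n -> 'rV[R]_n) :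
  (forall k, smooth (A k)) -> smooth (\sum_k c k *: A k).
Proof.
move=> sA; apply: big_ind => [|B B' sB sB'|k _]; first exact: smooth0.
  exact: smoothD.
exact: smoothZ.
Qed.

Lemma vf_bracket_suml (N : nat) (c : 'I_N -> R) (A : 'I_N -> 'rV[R]_n -> 'rV[R]_n) Y :
  (forall k, smooth (A k)) -> smooth Y ->
  vf_bracket (\sum_k c k *: A k) Y = \sum_k c k *: vf_bracket (A k) Y.
Proof.
move=> sA sY; apply/funext => x.
have -> : (\sum_k c k *: vf_bracket (A k) Y) x = \sum_k c k *: vf_bracket (A k) Y x.
  by rewrite fct_sumE.
rewrite /vf_bracket.
have -> : (\sum_k c k *: A k) x = \sum_k c k *: A k x by rewrite fct_sumE.
rewrite derive_dir_sum//.
have H : is_derive x (Y x) (\sum_k c k *: A k) (\sum_k c k *: 'D_(Y x) (A k) x).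
  apply: is_derive_sum => i; apply: is_deriveZ.
  exact/derivableP/smooth_derivable.
have [_ ->] := H; rewrite -sumrB; apply: eq_bigr => k _.
by rewrite -scalerBr.
Qed.

Lemma vf_bracket0l Y : smooth Y -> vf_bracket 0 Y = 0.
Proof.
move=> sY; apply/funext => x; rewrite /vf_bracket derive0 sub0r.
by rewrite derive_cst oppr0.
Qed.

Lemma vf_bracket0r Y : smooth Y -> vf_bracket Y 0 = 0.
Proof. by move=> sY; rewrite vf_bracketC vf_bracket0l// oppr0. Qed.

End brackets.

Section lin_span_theory.
Context {R : realType} {V : lmodType R}.
Implicit Types (S : set V) (x y : V).

Lemma lin_span0 S : lin_span S 0.
Proof.
exists 0%N, (fun=> 0), (fun=> 0); split=> [[]//|].
by rewrite big_ord0.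
Qed.

Lemma lin_span_id S x : S x -> lin_span S x.
Proof.
move=> Sx; exists 1%N, (fun=> 1), (fun=> x); split => //.
by rewrite big_ord1 scale1r.
Qed.

Lemma lin_spanZ S (c : R) x : lin_span S x -> lin_span S (c *: x).
Proof.
move=> [N [d [v [Sv ->]]]]; exists N, (fun k => c * d k), v; split => //.
by rewrite scaler_sumr; apply: eq_bigr => k _; rewrite scalerA.
Qed.

Lemma lin_spanD S x y : lin_span S x -> lin_span S y -> lin_span S (x + y).
Proof.
move=> [N [c [v [Sv ->]]]] [M [d [w [Sw ->]]]].
exists (N + M)%N.
exists (fun k => match fintype.split k with inl i => c i | inr j => d j end).
exists (fun k => match fintype.split k with inl i => v i | inr j => w j end).
split=> [k|]; first by case: (fintype.split k).
rewrite big_split_ord/=; congr (_ + _); apply: eq_bigr => i _.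
  by case: split_ordP => [j /lshift_inj ->//|j /eqP]; rewrite eq_lrshift.
by case: split_ordP => [j /eqP|j /rshift_inj ->//]; rewrite eq_rlshift.
Qed.

Lemma lin_span_sum S (I : Type) (r : seq I) (c : I -> R) (v : I -> V) :
  (forall i, lin_span S (v i)) -> lin_span S (\sum_(i <- r) c i *: v i).
Proof.
move=> Sv; apply: big_ind => [|x y|i _]; first exact: lin_span0.
  exact: lin_spanD.
exact: lin_spanZ.
Qed.

Lemma lin_span_set0 x : lin_span set0 x -> x = 0.
Proof.
move=> [N [c [v [Sv ->]]]]; apply: big1 => k _; by case: (Sv k).
Qed.

End lin_span_theory.

(** * Smooth maps on a product with one variable frozen *)

Section product_domain.
Context {R : realType} {U V W : normedModType R}.

Lemma smooth_pairl (g : U * V -> W) (y : V) :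
  smooth g -> smooth (fun x => g (x, y)).
Proof.
move=> sg k; elim: k g sg => [|k IH] g sg /=.
  move=> x; apply: (@continuous_comp _ _ _ (fun x => (x, y)) g).
    by apply: cvg_pair; [exact: cvg_id|exact: cvg_cst].
  exact: smooth_continuous.
have E x v : (fun h : R => h^-1 *: (((fun x => g (x, y)) \o shift x) (h *: v) - g (x, y)))
    = (fun h : R => h^-1 *: ((g \o shift (x, y)) (h *: (v, 0)) - g (x, y))).
  apply/funext => h /=; congr (_ *: (g _ - _)).
  have -> : h *: (v, 0) + (x, y) = (h *: v + x, h *: 0 + y) by [].
  by rewrite scaler0 add0r.
have D x v : is_derive x v (fun x => g (x, y)) ('D_(v, 0) g (x, y)).
  split; rewrite /derivable /derive E//.
  exact: (smooth_derivable (x, y) (v, 0) sg).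
split=> [x v|v]; first by case: (D x v).
rewrite (_ : 'D_v _ = fun x => 'D_(v, 0) g (x, y)).
  exact: (IH ('D_(v, 0) g) (smooth_derive _ sg)).
by apply/funext => x; case: (D x v).
Qed.

Lemma derive_pairr (g : U * V -> W) (x : U) (y v : V) :
  smooth g -> is_derive y v (fun y => g (x, y)) ('D_(0, v) g (x, y)).
Proof.
move=> sg.
have E : (fun h : R => h^-1 *: (((fun y => g (x, y)) \o shift y) (h *: v) - g (x, y)))
    = (fun h : R => h^-1 *: ((g \o shift (x, y)) (h *: (0, v)) - g (x, y))).
  apply/funext => h /=; congr (_ *: (g _ - _)).
  have -> : h *: (0, v) + (x, y) = (h *: 0 + x, h *: v + y) by [].
  by rewrite scaler0 add0r.
split; rewrite /derivable /derive E//.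
exact: (smooth_derivable (x, y) (0, v) sg).
Qed.

Lemma smooth_pairr (g : U * V -> W) (x : U) :
  smooth g -> smooth (fun y => g (x, y)).
Proof.
move=> sg k; elim: k g sg => [|k IH] g sg /=.
  move=> y; apply: (@continuous_comp _ _ _ (fun y => (x, y)) g).
    by apply: cvg_pair; [exact: cvg_cst|exact: cvg_id].
  exact: smooth_continuous.
split=> [y v|v]; first by case: (derive_pairr x y v sg).
rewrite (_ : 'D_v _ = fun y => 'D_(0, v) g (x, y)).
  exact: (IH ('D_(0, v) g) (smooth_derive _ sg)).
by apply/funext => y; case: (derive_pairr x y v sg).
Qed.

End product_domain.

(** * Left invariant fields and the grading of their brackets *)

Section group_fields.
Context {R : realType} {n : nat} (G : carnot_group R n).
Local Notation mul := (cg_mul G).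
Local Notation deg := (cg_deg G).
Local Notation X := (cg_field G).
Local Notation e_ j := (delta_mx 0 j : 'rV[R]_n).
Implicit Types (x y a v w : 'rV[R]_n).

Lemma smooth_mull x : smooth (mul x).
Proof. exact: (smooth_pairr x (cg_mul_smooth G)). Qed.

Lemma smooth_cg_field j : smooth (X j).
Proof.
rewrite (_ : X j = fun x => 'D_(0, e_ j) (fun p : 'rV[R]_n * 'rV[R]_n => mul p.1 p.2) (x, 0)).
  exact: (smooth_pairl 0 (smooth_derive (0, e_ j) (cg_mul_smooth G))).
by apply/funext => x; case: (derive_pairr x 0 (e_ j) (cg_mul_smooth G)).
Qed.

(** Left invariance of the fields: differentiate the associativity law for [x], [y] and [h *: e_ j]
    at h = 0. *)
Lemma cg_field_mul x y j : X j (mul x y) = 'D_(X j y) (mul x) y.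
Proof.
have D z : is_derive (0 : R) (1 : R) (fun h : R => mul z (h *: e_ j)) (X j z).
  have := @is_derive_line R _ _ (mul z) 0 (e_ j) 0 (smooth_derivable _ _ (smooth_mull z)).
  rewrite scale0r addr0; under eq_fun do rewrite add0r.
  exact.
have := is_derive_comp_curve_rV (smooth_mull x) (D y).
rewrite scale0r cg_mul0r => -[_ <-].
rewrite (_ : (fun s : R => mul x (mul y (s *: e_ j))) =
  (fun s : R => mul (mul x y) (s *: e_ j))); last first.
  by apply/funext => h; rewrite cg_mulA.
by have [_ ->] := D (mul x y).
Qed.

Lemma cg_field0 j : X j 0 = e_ j.
Proof.
rewrite /cg_field /basis_field (_ : mul 0 = id) ?derive_id//.
by apply/funext => x; rewrite cg_mul0l.
Qed.

Definition cg_lfield a x : 'rV[R]_n := \sum_j a 0 j *: X j x.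

Lemma is_derive_scalel (t : R) (a : 'rV[R]_n) : is_derive t (1 : R) (fun r : R => r *: a) a.
Proof.
apply/is_derive1_cvg.
have E (h : R) : h != 0 -> h^-1 *: ((h + t) *: a - t *: a) = a.
  by move=> h0; rewrite -scalerBl addrK scalerA mulVf// scale1r.
apply/cvg_dnbhs0P => e e0; exists 1 => // s s0 _.
by rewrite E// subrr normr0 ltW.
Qed.

(** The ray has constant velocity [a], which [cg_exp] also expresses through the fields. This is the
    form in which exponential coordinates enter all later arguments. *)
Lemma cg_lfield_ray a (t : R) : cg_lfield a (t *: a) = a.
Proof.
have [_ Da] := is_derive_scalel t a; have [_] := cg_exp G a t.
by rewrite Da => /esym.
Qed.

Lemma smooth_cg_lfield a : smooth (cg_lfield a).
Proof.
rewrite (_ : cg_lfield a = \sum_j a 0 j *: X j).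
  by apply: smooth_lin_comb => j; exact: smooth_cg_field.
by apply/funext => x; rewrite fct_sumE.
Qed.

Local Notation stratum := (stratum mul deg).

Lemma stratum_field j : stratum (deg j) (X j).
Proof. by apply: lin_span_id; exists j. Qed.

Lemma stratum_smooth i A : stratum i A -> smooth A.
Proof.
move=> [N [c [v [Sv ->]]]]; apply: smooth_lin_comb => k.
by have [j _ <-] := Sv k; exact: smooth_cg_field.
Qed.

Lemma stratum_lfield i A : stratum i A ->
  exists2 a : 'rV[R]_n, (forall j, deg j != i -> a 0 j = 0) & A = cg_lfield a.
Proof.
move=> [N [c [v [Sv ->]]]].
have /choice[f fP] : forall k, exists j, deg j = i /\ X j = v k.
  by move=> k; have [j dj <-] := Sv k; exists j.
exists (\sum_k c k *: e_ (f k)) => [j dj|].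
  rewrite summxE big1// => k _; rewrite !mxE eqxx/=.
  by case: eqP => [jE|_]; rewrite ?mulr0//; move: dj; rewrite jE (fP k).1 eqxx.
apply/funext => x; rewrite /cg_lfield fct_sumE.
under [RHS]eq_bigr do rewrite summxE scaler_suml.
rewrite exchange_big/=; apply: eq_bigr => k _.
rewrite (bigD1 (f k))//= big1 ?addr0 => [|j jk].
  by rewrite !mxE !eqxx mulr1 -(fP k).2.
by rewrite !mxE (negbTE jk) andbF mulr0 scale0r.
Qed.

Lemma stratum_gt i A : (cg_step G < i)%N -> stratum i A -> A = 0.
Proof.
move=> si; rewrite /Defs.stratum (_ : [set _ | _ in _] = set0); first exact: lin_span_set0.
apply/seteqP; split=> // B [j /= ji _].
by have /andP[_] := cg_deg_bound G j; rewrite ji leqNgt si.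
Qed.

Lemma stratum_bracket1 i A B : (0 < i)%N -> stratum 1 A -> stratum i B ->
  stratum i.+1 (vf_bracket A B).
Proof.
move=> i0 SA SB; have H : bracket_span (stratum 1) (stratum i) (vf_bracket A B).
  by apply: lin_span_id; exists A, B.
have [lt|gt|ei] := ltngtP i (cg_step G).
- by rewrite -cg_stratS// i0 lt.
- rewrite (stratum_gt gt SB) vf_bracket0r; first exact: lin_span0.
  exact: stratum_smooth SA.
- by move: H; rewrite ei cg_strat_last => ->; exact: lin_span0.
Qed.

(** Induction on [i]. An element of a higher stratum is a combination of brackets [C, D] with C in
    the first stratum and D one degree lower, and the Jacobi identity turns [[C, D], B] into [C,
    [D, B]] - [D, [C, B]], where D has the degree covered by the induction hypothesis. *)
Lemma stratum_bracket i j A B : (0 < i)%N -> (0 < j)%N ->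
  stratum i A -> stratum j B -> stratum (i + j) (vf_bracket A B).
Proof.
elim: i j A B => // i IH j A B _ j0 SA SB.
case: i IH SA => [_ SA|i IH SA]; first exact: stratum_bracket1.
(* [cg_stratS] is available only below the step; beyond it the stratum is zero. *)
have [si|si] := leqP (cg_step G) i.+1.
  rewrite (stratum_gt _ SA)// vf_bracket0l; first exact: lin_span0.
  exact: stratum_smooth SB.
move: SA; rewrite -cg_stratS// => -[N [c [v [Sv ->]]]].
have {Sv}/choice[P PP] : forall k, exists P : ('rV[R]_n -> 'rV[R]_n) * ('rV[R]_n -> 'rV[R]_n),
    [/\ stratum 1 P.1, stratum i.+1 P.2 & v k = vf_bracket P.1 P.2].
  by move=> k; have [C [D [SC SD E]]] := Sv k; exists (C, D).
have S k : stratum i.+2 (v k).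
  by have [SC SD ->] := PP k; exact: stratum_bracket1.
rewrite vf_bracket_suml; [|by move=> k; exact: stratum_smooth (S k)|exact: stratum_smooth SB].
apply: lin_span_sum => k; have [SC SD ->] := PP k.
rewrite vf_bracket_jacobi; [|exact: stratum_smooth SC|exact: stratum_smooth SD|exact: stratum_smooth SB].
rewrite -scaleN1r; apply: lin_spanD; last apply: lin_spanZ.
  by rewrite addSn; apply: stratum_bracket1 => //; exact: IH.
by rewrite addSnnS; apply: IH => //; exact: stratum_bracket1.
Qed.

(** The vanishing of [c i j k] off the degree [deg i + deg j] is what will make the Riccati system
    of the fields invariant under dilations. *)
Lemma structure_constants : exists c : 'I_n -> 'I_n -> 'I_n -> R,
  (forall i j k, deg k != (deg i + deg j)%N -> c i j k = 0) /\
  forall i j x, 'D_(X i x) (X j) x - 'D_(X j x) (X i) x = \sum_k c i j k *: X k x.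
Proof.
have d0 j : (0 < deg j)%N by case/andP: (cg_deg_bound G j).
have /choice[c cP] : forall p : 'I_n * 'I_n, exists a : 'rV[R]_n,
    (forall k, deg k != (deg p.1 + deg p.2)%N -> a 0 k = 0) /\
    vf_bracket (X p.1) (X p.2) = cg_lfield a.
  move=> [i j] /=.
  have [a a0 E] := stratum_lfield
    (stratum_bracket (d0 i) (d0 j) (stratum_field i) (stratum_field j)).
  by exists a.
exists (fun i j k => c (i, j) 0 k); split=> [i j k|i j x].
  exact: (cP (i, j)).1.
exact: (congr1 (fun A => A x) (cP (i, j)).2).
Qed.

End group_fields.

(** * Dilations *)

Section ode.
Context {R : realType}.

(** The sum s of the squares satisfies s' <= C s with C = 2 K |I|, since 2 |q_i| |q_l| <= q_i^2 +
    q_l^2. Hence s(r) exp(- C r) cannot rise above its initial value 0. The bound is asked only for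
    0 < r < 1 because the system treated below is singular at 0. *)
Lemma gronwall_zero (I : finType) (q dq : I -> R -> R) (K : R) : 0 <= K ->
  (forall i, q i 0 = 0) ->
  (forall i (r : R), is_derive r (1 : R) (q i) (dq i r)) ->
  (forall i (r : R), 0 < r < 1 -> `|dq i r| <= K * \sum_l `|q l r|) ->
  forall i, q i 1 = 0.
Proof.
move=> K0 q0 qd qb.
pose s (r : R) : R := \sum_i q i r ^+ 2.
pose C : R := K *+ #|I| *+ 2.
pose E (r : R) : R := s r * expR (- (C * r)).
have sd (r : R) : is_derive r (1 : R) s (\sum_i (2 * q i r * dq i r)).
  have -> : s = \sum_i (fun r => q i r ^+ 2).
    by apply/funext => x; rewrite fct_sumE.
  elim/big_ind2: _ => [|f df g dg Hf Hg|i _]; first exact: is_derive_cst.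
    exact: is_deriveD.
  have H := is_deriveM (qd i r) (qd i r).
  have -> : (fun r => q i r ^+ 2) = q i * q i by apply/funext => x; rewrite expr2.
  have -> : 2 * q i r * dq i r = q i r *: dq i r + q i r *: dq i r.
    by rewrite /GRing.scale/=; ring.
  exact: H.
have sb (r : R) : 0 < r < 1 -> \sum_i (2 * q i r * dq i r) <= C * s r.
  move=> r01; apply: (@le_trans _ _ (\sum_i \sum_l K * (q i r ^+ 2 + q l r ^+ 2))).
    apply: ler_sum => i _; rewrite -mulr_sumr.
    apply: (le_trans (ler_norm _)); rewrite !normrM ger0_norm//.
    apply: (@le_trans _ _ (2 * `|q i r| * (K * \sum_l `|q l r|))).
      by rewrite ler_wpM2l// qb.
    rewrite mulrCA ler_wpM2l// mulr_sumr; apply: ler_sum => l _.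
    rewrite -(real_normK (num_real (q i r))) -(real_normK (num_real (q l r))).
    rewrite -subr_ge0.
    have -> : `|q i r| ^+ 2 + `|q l r| ^+ 2 - 2 * `|q i r| * `|q l r| =
      (`|q i r| - `|q l r|) ^+ 2 by ring.
    exact: sqr_ge0.
  have cT : #|(xpredT : pred I)| = #|I| by exact: eq_card.
  under eq_bigr do rewrite -mulr_sumr big_split/= sumr_const cT.
  rewrite -mulr_sumr big_split/= sumr_const cT sumrMnl -/(s r).
  by rewrite /C -mulr2n !mulrnAl !mulrnAr.
have Ed (r : R) : is_derive r (1 : R) E
    ((\sum_i (2 * q i r * dq i r) - C * s r) * expR (- (C * r))).
  have H : is_derive r (1 : R) (fun r : R => r * - C) (- C) by exact: is_derive_mulrl.
  have H2 : is_derive r (1 : R) (fun r : R => expR (r * - C)) (expR (r * - C) * - C).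
    exact: (@is_derive1_comp R expR (fun r : R => r * - C) r _ _ (is_derive_expR _) H).
  have := is_deriveM (sd r) H2.
  have -> : s * (fun r : R => expR (r * - C)) = E.
    apply/funext => x; have EC : x * - C = - (C * x) by rewrite mulrN mulrC.
    by rewrite /E -EC.
  have -> : s r *: (expR (r * - C) * - C) + expR (r * - C) *: (\sum_i (2 * q i r * dq i r)) =
      (\sum_i (2 * q i r * dq i r) - C * s r) * expR (- (C * r)).
    have -> : r * - C = - (C * r) by rewrite mulrN mulrC.
    by rewrite /GRing.scale/=; ring.
  exact.
have E10 : E 1 <= E 0.
  apply: (@ler0_derive1_le_cc R E 0 1) => //; rewrite ?in_itv/= ?lexx ?ler01//.
  - move=> x; rewrite in_itv/= => x01; rewrite derive1E; have [_ ->] := Ed x.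
    by rewrite mulr_le0_ge0 ?expR_ge0// subr_le0 sb.
  - by apply: derivable_within_continuous => x _; case: (Ed x).
have s10 : s 1 <= 0.
  move: E10; rewrite /E [s 0]big1 ?mul0r => [|i _]; last by rewrite q0 expr0n.
  by rewrite pmulr_lle0// expR_gt0.
move=> i; apply/eqP; rewrite -sqrf_eq0 eq_le sqr_ge0 andbT.
apply: le_trans s10; rewrite /s (bigD1 i)//= lerDl.
by apply: sumr_ge0 => l _; exact: sqr_ge0.
Qed.

Lemma ode_unique n (F : 'rV[R]_n -> 'rV[R]_n) (p q : R -> 'rV[R]_n) : smooth F ->
  (forall r : R, is_derive r (1 : R) p (F (p r))) ->
  (forall r : R, is_derive r (1 : R) q (F (q r))) ->
  p 0 = q 0 -> p 1 = q 1.
Proof.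
move=> sF pd qd pq0.
have bd (g : R -> 'rV[R]_n) : (forall r : R, is_derive r (1 : R) g (F (g r))) ->
    exists M : R, forall r, 0 <= r <= 1 -> `|g r| <= M.
  move=> gd; have [|c _ cP] := @EVT_max R (fun r => `|g r|) 0 1 ler01.
    apply: continuous_subspaceT => x.
    apply: (@continuous_comp _ _ _ g (fun y => `|y|)); last exact: norm_continuous.
    exact: is_derive_continuous (gd x).
  by exists `|g c| => r r01; apply: cP; rewrite in_itv.
have [M1 P1] := bd p pd; have [M2 P2] := bd q qd.
have [K K0 KP] := smooth_lipschitz_on_ball (Num.max M1 M2) sF.
apply/rowP => i; apply/eqP; rewrite -subr_eq0; apply/eqP.
apply: (@gronwall_zero 'I_n (fun i r => p r 0 i - q r 0 i)
  (fun i r => F (p r) 0 i - F (q r) 0 i) K K0) => {i}.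
- by move=> i; rewrite pq0 subrr.
- move=> i r; have [Dp Ep] := pd r; have [Dq Eq] := qd r.
  have := is_derive_coord i Dp; have := is_derive_coord i Dq; rewrite Ep Eq.
  by move=> h1 h2; exact: is_deriveB h2 h1.
- move=> i r /andP[r0 r1].
  have r01 : 0 <= r <= 1 by rewrite !ltW.
  have := KP (p r) (q r); rewrite !le_max P1// P2// orbT => /(_ isT isT) H.
  apply: (@le_trans _ _ `|F (p r) - F (q r)|).
    by have := rV_coord_le (F (p r) - F (q r)) i; rewrite !mxE.
  apply: le_trans H _; rewrite ler_wpM2l//; apply: rV_norm_le => [|l].
    exact: sumr_ge0.
  by rewrite !mxE (bigD1 l)//= lerDl sumr_ge0.
Qed.

(* The system is singular at r = 0, but [r (y - z)] satisfies a linear inequality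
   with bounded coefficients. *)
Lemma riccati_unique n (a : 'I_n -> R) (c : 'I_n -> 'I_n -> 'I_n -> R)
    (y z dy dz : 'I_n -> 'I_n -> R -> R) (K : R) : 0 <= K ->
  (forall j k (r : R), is_derive r (1 : R) (y j k) (dy j k r)) ->
  (forall j k (r : R), is_derive r (1 : R) (z j k) (dz j k r)) ->
  (forall j k r, r * dy j k r = y j k r - \sum_i y j i r * y i k r
     + r * \sum_i a i * \sum_l c i j l * y l k r) ->
  (forall j k r, r * dz j k r = z j k r - \sum_i z j i r * z i k r
     + r * \sum_i a i * \sum_l c i j l * z l k r) ->
  (forall j k r, 0 < r < 1 -> `|(j == k)%:R - y j k r| <= K * r) ->
  (forall j k r, 0 < r < 1 -> `|(j == k)%:R - z j k r| <= K * r) ->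
  forall j k, y j k 1 = z j k 1.
Proof.
move=> K0 yd zd yE zE yb zb j k.
pose q (p : 'I_n * 'I_n) (r : R) := r * (y p.1 p.2 r - z p.1 p.2 r).
pose dq (p : 'I_n * 'I_n) (r : R) :=
  (y p.1 p.2 r - z p.1 p.2 r) + r * (dy p.1 p.2 r - dz p.1 p.2 r).
pose M : R := \sum_j' \sum_i \sum_l `|a i * c i j' l|.
have M0 : 0 <= M by do 3 (apply: sumr_ge0 => ? _).
pose K' : R := K *+ n + K *+ n + M.
have K'0 : 0 <= K' by rewrite !addr_ge0 ?mulrn_wge0.
suff : q (j, k) 1 = 0 by rewrite /q mul1r => /subr0_eq.
apply: (@gronwall_zero _ q dq K' K'0) => {j k}.
- by move=> p; rewrite /q mul0r.
- move=> [j k] r; have h1 := is_deriveB (yd j k r) (zd j k r).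
  have := is_deriveM (@is_derive_id _ _ r 1) h1.
  move=> H; apply: (is_derive_eq (f := q (j, k)) H).
  rewrite /dq/= /GRing.scale/= mulr1 addrC; congr (_ + _).
- move=> [j k] r r01; have /andP[r0 r1] := r01; set Q := \sum_l _.
  have qQ p : `|q p r| <= Q by rewrite /Q (bigD1 p)//= lerDl sumr_ge0.
  clearbody Q.
  have Pq p : r * `|y p.1 p.2 r - z p.1 p.2 r| = `|q p r|.
    by rewrite /q normrM (gtr0_norm r0).
  (* [y - z] occurs twice, once from differentiating the factor [r] and once from the equations. The
     two copies are absorbed in the factors [(j == i)%:R - y j i r] and [(i == k)%:R - z i k r],
     which are O(r), so that every summand is at most a constant times some r |y - z| = |q|. *)
  have -> : dq (j, k) r =
      \sum_i ((j == i)%:R - y j i r) * (y i k r - z i k r)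
    + \sum_i (y j i r - z j i r) * ((i == k)%:R - z i k r)
    + r * \sum_i a i * \sum_l c i j l * (y l k r - z l k r).
    have d1 (f : 'I_n -> R) : \sum_i (j == i)%:R * f i = f j.
      rewrite (bigD1 j)//= eqxx mul1r big1 ?addr0// => i ij.
      by rewrite eq_sym (negbTE ij) mul0r.
    have d2 (f : 'I_n -> R) : \sum_i f i * (i == k)%:R = f k.
      rewrite (bigD1 k)//= eqxx mulr1 big1 ?addr0// => i ik.
      by rewrite (negbTE ik) mulr0.
    under eq_bigr do rewrite mulrBl.
    under [X in _ + X + _]eq_bigr do rewrite mulrBr.
    rewrite !sumrB d1 d2.
    have -> : \sum_i a i * \sum_l c i j l * (y l k r - z l k r) =
       \sum_i a i * \sum_l c i j l * y l k r - \sum_i a i * \sum_l c i j l * z l k r.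
      rewrite -sumrB; apply: eq_bigr => i _; rewrite -mulrBr -sumrB; congr (_ * _).
      by apply: eq_bigr => l _; rewrite mulrBr.
    rewrite /dq/= mulrBr yE zE.
    have E : \sum_i y j i r * y i k r - \sum_i z j i r * z i k r =
       \sum_i y j i r * (y i k r - z i k r) + \sum_i (y j i r - z j i r) * z i k r.
      by rewrite -sumrB -big_split/=; apply: eq_bigr => i _; ring.
    move: E; move: (\sum_i y j i r * y i k r) (\sum_i z j i r * z i k r).
    move: (\sum_i y j i r * (y i k r - z i k r)) => u1.
    move: (\sum_i (y j i r - z j i r) * z i k r) => u2 u3 u4.
    move=> /eqP; rewrite subr_eq => /eqP ->; ring.
  rewrite /K' !mulrDl; apply: (le_trans (ler_normD _ _)); apply: lerD.
    apply: (le_trans (ler_normD _ _)); apply: lerD.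
      apply: (le_trans (ler_norm_sum _ _ _)).
      rewrite mulrnAl -[X in _ *+ X](card_ord n) -sumr_const; apply: ler_sum => i _.
      rewrite normrM; apply: (@le_trans _ _ (K * r * `|y i k r - z i k r|)).
        by rewrite ler_wpM2r// yb.
      by rewrite -mulrA (Pq (i, k)) ler_wpM2l.
    apply: (le_trans (ler_norm_sum _ _ _)).
    rewrite mulrnAl -[X in _ *+ X](card_ord n) -sumr_const; apply: ler_sum => i _.
    rewrite normrM mulrC; apply: (@le_trans _ _ (K * r * `|y j i r - z j i r|)).
      by rewrite ler_wpM2r// zb.
    by rewrite -mulrA (Pq (j, i)) ler_wpM2l.
  rewrite mulr_sumr; apply: (le_trans (ler_norm_sum _ _ _)).
  apply: (@le_trans _ _ ((\sum_i \sum_l `|a i * c i j l|) * Q)); last first.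
    apply: ler_wpM2r; first exact: le_trans (normr_ge0 _) (qQ (j, k)).
    rewrite /M [leRHS](bigD1 j)//= lerDl; do 3 (apply: sumr_ge0 => ? _).
    exact: normr_ge0.
  rewrite mulr_suml; apply: ler_sum => i _; rewrite !mulr_sumr mulr_suml.
  apply: (le_trans (ler_norm_sum _ _ _)); apply: ler_sum => l _.
  have -> : r * (a i * (c i j l * (y l k r - z l k r))) =
    (a i * c i j l) * (r * (y l k r - z l k r)) by ring.
  by rewrite normrM ler_wpM2l// (qQ (l, k)).
Qed.

End ode.

(** * Homogeneity of the fields; dilations as automorphisms *)

Section dilations.
Context {R : realType} {n : nat} (G : carnot_group R n).
Local Notation mul := (cg_mul G).
Local Notation deg := (cg_deg G).
Local Notation X := (cg_field G).
Local Notation dil := (dilation G).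
Local Notation e_ j := (delta_mx 0 j : 'rV[R]_n).
Implicit Types (x y a v w : 'rV[R]_n) (t r : R).

Lemma deg_gt0 j : (0 < deg j)%N.
Proof. by case/andP: (cg_deg_bound G j). Qed.

Lemma dilationM t s x : dil t (dil s x) = dil (t * s) x.
Proof. by apply/rowP => j; rewrite !mxE exprMn mulrA. Qed.

Lemma dilation1 x : dil 1 x = x.
Proof. by apply/rowP => j; rewrite !mxE expr1n mul1r. Qed.

Lemma dilationVK t : t != 0 -> cancel (dil t^-1) (dil t).
Proof. by move=> t0 x; rewrite dilationM mulfV// dilation1. Qed.

Lemma dilationr0 t : dil t 0 = 0.
Proof. by apply/rowP => j; rewrite !mxE mulr0. Qed.

Lemma dilationZ t c x : dil t (c *: x) = c *: dil t x.
Proof. by apply/rowP => j; rewrite !mxE mulrCA. Qed.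

Lemma dilationB t x y : dil t (x - y) = dil t x - dil t y.
Proof. by apply/rowP => j; rewrite !mxE mulrBr. Qed.

Lemma dilation_V1 t E : in_V1 G E -> dil t E = t *: E.
Proof.
move=> EV; apply/rowP => j; rewrite !mxE.
by have [->|/eqP dj] := eqVneq (deg j) 1%N; [rewrite expr1|rewrite EV// !mulr0].
Qed.

Lemma dilation_norm_le t x : `|t| <= 1 -> `|dil t x| <= `|t| * `|x|.
Proof.
move=> t1; apply: rV_norm_le => [|j]; first by rewrite mulr_ge0.
rewrite mxE normrM normrX; apply: ler_pM => //; last exact: rV_coord_le.
by rewrite -[leRHS]expr1; apply: ler_wiXn2l => //; exact: deg_gt0.
Qed.

Lemma dilation_norm_le_gen t : exists2 K : R, 0 <= K & forall x, `|dil t x| <= K * `|x|.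
Proof.
exists (\sum_j `|t| ^+ deg j); first by apply: sumr_ge0 => j _; rewrite exprn_ge0.
move=> y; apply: rV_norm_le => [|j].
  by rewrite mulr_ge0// sumr_ge0// => j _; rewrite exprn_ge0.
rewrite mxE normrM normrX; apply: ler_pM; rewrite ?exprn_ge0//; last exact: rV_coord_le.
by rewrite (bigD1 j)//= lerDl sumr_ge0// => i _; rewrite exprn_ge0.
Qed.

Let rV_subE (u v : 'rV[R]_n) k : (u - v) 0 k = u 0 k - v 0 k.
Proof. by rewrite !mxE. Qed.

Lemma cg_lfieldE a x k : cg_lfield G a x 0 k = \sum_j a 0 j * X j x 0 k.
Proof. by rewrite summxE; apply: eq_bigr => j _; rewrite mxE. Qed.

(** This is the derivative along [v] of the identity sum_i y_i X_i(y) = y, that is, of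
    [cg_lfield_ray] at time 1. *)
Lemma euler_derive p v k :
  \sum_i (v 0 i * X i p 0 k + p 0 i * ('D_v (X i) p) 0 k) = v 0 k.
Proof.
have H : is_derive p v (fun y => y 0 k)
    (\sum_i (p 0 i * ('D_v (X i) p) 0 k + X i p 0 k * v 0 i)).
  have -> : (fun y : 'rV[R]_n => y 0 k) = \sum_i (fun y : 'rV[R]_n => y 0 i * X i y 0 k).
    apply/funext => y; have := cg_lfield_ray G y 1; rewrite scale1r => {1}<-.
    by rewrite /cg_lfield summxE fct_sumE; apply: eq_bigr => i _; rewrite mxE.
  apply: is_derive_sum => i.
  have h1 : is_derive p v (fun y : 'rV[R]_n => y 0 i) (v 0 i).
    have [Di Ei] := is_derive_id p v.
    by have := is_derive_coord i Di; rewrite Ei.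
  have h2 := is_derive_coord k (smooth_derivable p v (smooth_cg_field G i)).
  exact: is_deriveM h1 h2.
have [Dk Ek] := is_derive_id p v.
have := is_derive_coord k Dk; rewrite Ek => -[_ <-]; have [_ ->] := H.
by apply: eq_bigr => i _; rewrite addrC [X in _ + X]mulrC.
Qed.

(* Differentiate [sum_i y_i X_i(y) = y] at [y = r a] in the direction [X_j], and
   exchange [D_(X_j) X_i] and [D_(X_i) X_j] by means of the structure constants. *)
Lemma riccati_field (c : 'I_n -> 'I_n -> 'I_n -> R) a j k r :
  (forall i j x, 'D_(X i x) (X j) x - 'D_(X j x) (X i) x = \sum_k c i j k *: X k x) ->
  r * ('D_a (X j) (r *: a)) 0 k = X j (r *: a) 0 k
    - \sum_i X j (r *: a) 0 i * X i (r *: a) 0 k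
    + r * \sum_i a 0 i * \sum_l c i j l * X l (r *: a) 0 k.
Proof.
move=> cE; set p := r *: a.
have -> : 'D_a (X j) p = \sum_i a 0 i *: 'D_(X i p) (X j) p.
  rewrite -[in LHS](cg_lfield_ray G a r).
  exact: (derive_dir_sum p (a 0) (fun i => X i p) (smooth_cg_field G j)).
have H i : ('D_(X i p) (X j) p) 0 k = ('D_(X j p) (X i) p) 0 k + \sum_l c i j l * X l p 0 k.
  have aux (u v s : R) : u - v = s -> u = v + s by move=> <-; rewrite addrC subrK.
  have S : (\sum_l c i j l *: X l p) 0 k = \sum_l c i j l * X l p 0 k.
    by rewrite summxE; apply: eq_bigr => l _; rewrite mxE.
  exact: (aux _ _ _ (eq_trans (esym (rV_subE _ _ k))
    (eq_trans (congr1 (fun u : 'rV[R]_n => u 0 k) (cE i j p)) S))).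
rewrite summxE.
under eq_bigr do rewrite mxE H mulrDr.
rewrite big_split/= mulrDr; congr (_ + _).
have E := euler_derive p (X j p) k; rewrite big_split/= in E.
have -> : r * \sum_i a 0 i * ('D_(X j p) (X i) p) 0 k =
    \sum_i p 0 i * ('D_(X j p) (X i) p) 0 k.
  by rewrite mulr_sumr; apply: eq_bigr => i _; rewrite mulrA [in RHS]mxE.
have aux (u v w : R) : u + v = w -> v = w - u by move=> <-; rewrite addrC addKr.
exact: aux E.
Qed.

(** X_j(0) = e_j and X_j is Lipschitz on the ball of radius |a|. This supplies the O(r) hypotheses
    of [riccati_unique], which single out the solution with the right value at the singular
    point. *)
Lemma cg_field_ray_bound a : exists2 K : R, 0 <= K &
  forall j k r, 0 < r < 1 -> `|(j == k)%:R - X j (r *: a) 0 k| <= K * r.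
Proof.
have /choice[K KP] : forall j, exists K : R, 0 <= K /\
    forall x y, `|x| <= `|a| -> `|y| <= `|a| -> `|X j x - X j y| <= K * `|x - y|.
  move=> j; have [K K0 KP] := smooth_lipschitz_on_ball `|a| (smooth_cg_field G j).
  by exists K.
have S0 : 0 <= \sum_j K j by apply: sumr_ge0 => j _; case: (KP j).
exists ((\sum_j K j) * `|a|); first by rewrite mulr_ge0.
move=> j k r /andP[r0 r1].
have := (KP j).2 0 (r *: a); rewrite normr0 normr_ge0 => /(_ isT).
have ra : `|r *: a| = r * `|a| by rewrite normrZ gtr0_norm.
rewrite ra ler_piMl ?(ltW r1)// => /(_ isT); rewrite sub0r normrN ra cg_field0 => H.
apply: (@le_trans _ _ `|e_ j - X j (r *: a)|).
  have := rV_coord_le (e_ j - X j (r *: a)) k.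
  by rewrite !mxE eqxx/= (eq_sym k).
apply: le_trans H _; rewrite -mulrA (mulrC `|a|) ler_wpM2r//.
  by rewrite mulr_ge0// ltW.
by rewrite (bigD1 j)//= lerDl sumr_ge0// => i _; case: (KP i).
Qed.

(** The components of the fields along [r *: x], and the suitably rescaled components along
    [r *: dil t x], solve the same Riccati system with coefficients [x 0 i]; they are compared at r
    = 1. *)
Lemma cg_field_dilation t x j k : t != 0 ->
  t ^+ deg k * X j x 0 k = t ^+ deg j * X j (dil t x) 0 k.
Proof.
move=> t0; have [c [c0 cE]] := structure_constants G.
have td i : t ^+ deg i != 0 by rewrite expf_neq0.
pose y (j k : 'I_n) r := X j (r *: x) 0 k.
pose z (j k : 'I_n) r := t ^+ deg j / t ^+ deg k * X j (r *: dil t x) 0 k.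
have [K1 K10 K1P] := cg_field_ray_bound x.
have [K2 K20 K2P] := cg_field_ray_bound (dil t x).
pose T : R := \sum_j \sum_k `|t ^+ deg j / t ^+ deg k|.
have TP j' k' : `|t ^+ deg j' / t ^+ deg k'| <= T.
  rewrite /T (bigD1 j')//= (bigD1 k')//= -addrA lerDl addr_ge0// sumr_ge0// => i _.
  exact: sumr_ge0.
have T0 : 0 <= T by apply: sumr_ge0 => i _; exact: sumr_ge0.
have fd a j' k' r : is_derive r (1 : R) (fun r => X j' (r *: a) 0 k')
    (('D_a (X j') (r *: a)) 0 k').
  have := @is_derive_line R _ _ (X j') 0 a r (smooth_derivable _ _ (smooth_cg_field G j')).
  rewrite add0r; under eq_fun do rewrite add0r.
  by move=> [D E]; have := is_derive_coord k' D; rewrite E.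
have : y j k 1 = z j k 1.
  apply: (@riccati_unique R n (x 0) c y z
    (fun j k r => ('D_x (X j) (r *: x)) 0 k)
    (fun j k r => t ^+ deg j / t ^+ deg k * ('D_(dil t x) (X j) (r *: dil t x)) 0 k)
    (K1 + T * K2)) => {j k}.
  - by rewrite addr_ge0// mulr_ge0.
  - by move=> j k r; exact: riccati_field.
  - move=> j k r; rewrite mulrCA (riccati_field _ _ _ _ cE) /z mulrDr mulrBr.
    congr (_ - _ + _).
      rewrite mulr_sumr; apply: eq_bigr => i _.
      have -> : t ^+ deg j / t ^+ deg k = (t ^+ deg j / t ^+ deg i) * (t ^+ deg i / t ^+ deg k).
        by rewrite mulrA divfK.
      ring.
    rewrite mulrCA; congr (_ * _); rewrite mulr_sumr; apply: eq_bigr => i _.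
    have aux (u v w s : R) : u * (v * w * s) = w * (u * v * s) by ring.
    rewrite [dil t x 0 i]mxE aux; congr (_ * _).
    rewrite mulr_sumr; apply: eq_bigr => l _.
    (* Here the grading enters: either the powers of [t] balance exactly, or the structure constant
       is 0. *)
    have [El|Nl] := eqVneq (deg l) (deg i + deg j)%N.
      by rewrite El exprD; field; rewrite !td.
    by rewrite c0// !(mul0r, mulr0).
  - move=> j k r r01; apply: le_trans (K1P j k r r01) _.
    have /andP[r0 _] := r01.
    by rewrite ler_wpM2r ?(ltW r0)// lerDl mulr_ge0.
  - move=> j k r r01; have /andP[r0 _] := r01.
    have -> : (j == k)%:R - z j k r =
        t ^+ deg j / t ^+ deg k * ((j == k)%:R - X j (r *: dil t x) 0 k).
      rewrite mulrBr; congr (_ - _); have [->|] := eqVneq j k; last by rewrite mulr0.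
      by rewrite mulr1 divff.
    rewrite normrM mulrDl; apply: (@le_trans _ _ (T * K2 * r)).
      by rewrite -mulrA; apply: ler_pM => //; exact: K2P.
    by rewrite lerDr mulr_ge0// ltW.
rewrite /y /z !scale1r => ->.
by rewrite mulrA mulrCA divff// mulr1.
Qed.

(** Triangularity of the fields, by letting t tend to 0 in the homogeneity relation, where X_j(dil t
    x) tends to e_j. For equal degrees the power of t is 1; otherwise it tends to 0, and j differs
    from k. *)
Lemma cg_field_high j k x : (deg k <= deg j)%N -> X j x 0 k = (j == k)%:R.
Proof.
move=> kj.
have E t : t != 0 -> X j x 0 k = t ^+ (deg j - deg k) * X j (dil t x) 0 k.
  move=> t0; have td : t ^+ deg k != 0 by rewrite expf_neq0.
  by apply: (mulfI td); rewrite cg_field_dilation// mulrA -exprD subnKC.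
have C : t ^+ (deg j - deg k) * X j (dil t x) 0 k @[t --> (0 : R)^'] -->
    (0 : R) ^+ (deg j - deg k) * (j == k)%:R.
  apply: cvgM.
    have : {for (0:R), continuous (fun t : R => t ^+ (deg j - deg k))}.
      exact: exprn_continuous.
    by move=> H; apply: cvg_within_filter; exact: H.
  rewrite (_ : (j == k)%:R = X j 0 0 k); last by rewrite cg_field0 mxE eqxx/= eq_sym.
  apply: (@cvg_comp _ _ _ (fun t => dil t x) (fun y => X j y 0 k) _ (nbhs (0 : 'rV[R]_n))).
    apply/cvg_dnbhs0P => e e0.
    exists (Num.min 1 (e / (1 + `|x|))); first by rewrite lt_min ltr01 divr_gt0// ltr_wpDr.
    move=> s s0; rewrite lt_min => /andP[s1 se]; rewrite subr0.
    apply: le_trans (dilation_norm_le _ (ltW s1)) _.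
    apply: le_trans (ler_wpM2r (normr_ge0 x) (ltW se)) _.
    by rewrite mulrAC ler_pdivrMr ?ltr_wpDr// ler_wpM2l ?(ltW e0)// lerDr.
  exact: (smooth_continuous (smooth_coord k (smooth_cg_field G j))).
have C' : X j x 0 k @[t --> (0 : R)^'] --> (0 : R) ^+ (deg j - deg k) * (j == k)%:R.
  apply: cvg_trans C; apply: near_eq_cvg; near=> t; rewrite -E//.
  by near: t; exact: nbhs_dnbhs_neq.
have -> : X j x 0 k = (0 : R) ^+ (deg j - deg k) * (j == k)%:R.
  exact: (cvg_unique _ (cvg_cst _) C').
have [->|_] := eqVneq j k; first by rewrite subnn expr0 mul1r.
by rewrite mulr0.
Unshelve. all: by end_near. Qed.

Lemma is_derive_mul_ray x a r :
  is_derive r (1 : R) (fun r : R => mul x (r *: a)) (cg_lfield G a (mul x (r *: a))).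
Proof.
have := is_derive_comp_curve_rV (smooth_mull G x) (is_derive_scalel r a).
have E : 'D_(cg_lfield G a (r *: a)) (mul x) (r *: a) = \sum_j a 0 j *: _ :=
  derive_dir_sum (r *: a) (a 0) (fun j => X j (r *: a)) (smooth_mull G x).
rewrite cg_lfield_ray in E; rewrite E.
by under eq_bigr do rewrite -cg_field_mul.
Qed.

Lemma dilation_mul t x y : t != 0 -> dil t (mul x y) = mul (dil t x) (dil t y).
Proof.
move=> t0.
have := @ode_unique R n (cg_lfield G (dil t y))
  (fun r => dil t (mul x (r *: y))) (fun r => mul (dil t x) (r *: dil t y)).
rewrite !scale1r !scale0r !cg_mul0r; apply => //.
- exact: smooth_cg_lfield.
- move=> r; have [D E] := is_derive_mul_ray x y r.
  have H j : is_derive r (1 : R) (fun r => dil t (mul x (r *: y)) 0 j)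
      (t ^+ deg j * cg_lfield G y (mul x (r *: y)) 0 j).
    have := is_deriveZ (t ^+ deg j) (is_derive_coord j D); rewrite E.
    have -> : (fun r => dil t (mul x (r *: y)) 0 j) =
       t ^+ deg j *: (fun r : R => mul x (r *: y) 0 j).
      by apply/funext => s; rewrite mxE.
    exact.
  have D' : derivable (fun r => dil t (mul x (r *: y))) r 1.
    by apply/derivable_mxP => i j; rewrite ord1; case: (H j).
  split; first exact: D'.
  apply/rowP => j; rewrite (derive_coord j D'); have [_ ->] := H j.
  rewrite !cg_lfieldE mulr_sumr; apply: eq_bigr => k _.
  by rewrite [dil t y 0 k]mxE mulrCA cg_field_dilation// mulrA (mulrC (y 0 k)).
- by move=> r; exact: is_derive_mul_ray.
Qed.

(** Along r -> x * (r a) the j-th coordinate has constant derivative [a 0 j]: fields of degree at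
    least [deg j] are triangular there, and those of lower degree have coefficient 0. *)
Lemma cg_mul_coord x a j : (forall k, (deg k < deg j)%N -> a 0 k = 0) ->
  mul x a 0 j = x 0 j + a 0 j.
Proof.
move=> a0.
have E y : cg_lfield G a y 0 j = a 0 j.
  rewrite cg_lfieldE (bigD1 j) 1?[RHS]lock//= -lock cg_field_high ?leqnn// eqxx mulr1.
  rewrite big1 ?addr0 => [//|k kj].
  have [/a0 ->|jk] := ltnP (deg k) (deg j); first by rewrite mul0r.
  by rewrite cg_field_high// (negbTE kj) mulr0.
have H (r : R) : is_derive r (1 : R) (fun r : R => mul x (r *: a) 0 j) (a 0 j).
  have [D F] := is_derive_mul_ray x a r.
  by have := is_derive_coord j D; rewrite F E.
have [|th _] := @MVT_segment R (fun r : R => mul x (r *: a) 0 j) (fun=> a 0 j) 0 1 ler01 (fun r _ => H r).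
  by apply: derivable_within_continuous => r _; case: (H r).
by rewrite scale1r scale0r cg_mul0r subr0 mulr1 => /eqP; rewrite subr_eq addrC => /eqP.
Qed.

End dilations.

(** * Absolutely continuous curves *)

Section gauge.
Context {R : realType}.

(* Cousin's lemma. *)
Lemma interval_induction (P : R -> R -> Prop) (a b : R) : a <= b ->
  (forall x y z, a <= x -> x <= y -> y <= z -> z <= b -> P x y -> P y z -> P x z) ->
  (forall t, a <= t -> t <= b -> exists2 rho : R, 0 < rho &
    forall x y, a <= x -> x <= t -> t <= y -> y <= b -> t - rho < x -> y < t + rho ->
      P x y) ->
  P a b.
Proof.
move=> ab Ptrans Ploc.
pose S := [set y | a <= y /\ y <= b /\ P a y].
have Sa : S a.
  split=> //; split=> //; have [rho rho0 Q] := Ploc a (lexx a) ab.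
  by apply: Q; rewrite ?lexx// ?ltrBlDr ltrDl.
have Sb : has_sup S by split; [exists a|exists b => y [_ []]].
have Sle y : S y -> y <= sup S by move=> Sy; apply: sup_upper_bound.
have ac : a <= sup S by exact: Sle.
have cb : sup S <= b by apply: ge_sup; [exists a|move=> y [_ []]].
have [rho rho0 Q] := Ploc (sup S) ac cb.
have [y [ay [yb Pay]] yc] := sup_adherent rho0 Sb.
have yS : y <= sup S by exact: Sle.
pose z : R := Num.min (sup S + rho / 2) b.
have r2 : 0 < rho / 2 by rewrite divr_gt0.
have cz : sup S <= z by rewrite le_min cb lerDl ltW.
have zb : z <= b by rewrite ge_min lexx orbT.
have Sz : S z.
  split; first exact: le_trans cz.
  split=> //; apply: (Ptrans a y z) => //; first exact: le_trans cz.
  apply: Q => //; rewrite gt_min; apply/orP; left.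
  by rewrite ltrD2l ltr_pdivrMr// mulr_natr mulr2n ltrDl.
have : z <= sup S by exact: Sle.
rewrite ge_min => /orP[|bc]; first by rewrite gerDl leNgt r2.
have bE : b = z by apply/eqP; rewrite eq_le zb andbT (le_trans bc).
by rewrite bE; case: Sz => _ [].
Qed.

(* The intervals [l, r] listed in [s] lie one after the other in [x, y]. *)
Fixpoint itv_chain (x : R) (s : seq (R * R)) (y : R) : Prop :=
  if s is (l, r) :: s' then [/\ x <= l, l <= r & itv_chain r s' y] else x <= y.

Lemma itv_chain_le x s y : itv_chain x s y -> x <= y.
Proof.
elim: s x => [//|[l r] s IH] x /= [xl lr /IH ry].
by rewrite (le_trans xl)// (le_trans lr).
Qed.

Lemma itv_chain_cat x s y s' z : itv_chain x s y -> itv_chain y s' z ->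
  itv_chain x (s ++ s') z.
Proof.
elim: s x => [x /= xy|[l r] s IH x /= [xl lr h] h']; last by split=> //; exact: IH.
case: s' => [/=|[l r] s' /= [yl lr h]]; first exact: le_trans.
by split=> //; exact: le_trans yl.
Qed.

Lemma itv_chain_nth x s y k : itv_chain x s y -> (k < size s)%N ->
  [/\ x <= (nth (0, 0) s k).1, (nth (0, 0) s k).1 <= (nth (0, 0) s k).2 &
      (nth (0, 0) s k).2 <= y].
Proof.
elim: s x k => [//|[l r] s IH] x [|k] /= [xl lr h] ks.
  by split=> //; exact: itv_chain_le h.
have [h1 h2 h3] := IH r k h ks; split=> //.
by rewrite (le_trans xl)// (le_trans lr).
Qed.

Lemma itv_chain_disjoint x s y j k : itv_chain x s y -> (j < k)%N ->
  (k < size s)%N -> (nth (0, 0) s j).2 <= (nth (0, 0) s k).1.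
Proof.
elim: s x j k => [//|[l r] s IH] x [|j] [|k] //= [xl lr h] jk ks.
  by have [] := itv_chain_nth h ks.
exact: (IH r j k).
Qed.

(** Lists of consecutive intervals can be concatenated, which is what Cousin's lemma demands;
    indexed disjoint families are awkward there. *)
Lemma abs_continuous_chain (V : normedModType R) (a b : R) (gamma : R -> V) :
  abs_continuous a b gamma -> forall e : R, 0 < e -> exists2 d : R, 0 < d &
  forall s, itv_chain a s b -> \sum_(p <- s) (p.2 - p.1) < d ->
    \sum_(p <- s) `|gamma p.2 - gamma p.1| < e.
Proof.
move=> ac e e0; have [d d0 dP] := ac e e0; exists d => // s cs sd.
have E (F : R * R -> R) : \sum_(k < size s) F (nth (0, 0) s k) = \sum_(p <- s) F p.
  by rewrite (big_nth (0, 0)) big_mkord.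
have := dP (size s) (fun k => (nth (0, 0) s k).1) (fun k => (nth (0, 0) s k).2).
rewrite (E (fun p => p.2 - p.1)) (E (fun p => `|gamma p.2 - gamma p.1|)).
apply=> //; first by move=> k; have [] := itv_chain_nth cs (ltn_ord k).
move=> j k _ _ [t [/=]]; rewrite !in_itv/= => /andP[lj rj] /andP[lk rk].
apply/val_inj; have [jk|kj|//] := ltngtP j k.
  have := itv_chain_disjoint cs jk (ltn_ord k).
  by rewrite leNgt (lt_trans lk).
have := itv_chain_disjoint cs kj (ltn_ord j).
by rewrite leNgt (lt_trans lj).
Qed.

(* The intervals tagged in the exceptional set [B] have total length at most
   [M b - M a], so that absolute continuity controls their contribution. *)
Lemma abs_continuous_gauge (V : normedModType R) (gamma : R -> V) (Phi : R -> R)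
    (a b : R) (B : set R) : a <= b -> abs_continuous a b gamma ->
  (forall x y, a <= x -> x <= y -> y <= b -> Phi x <= Phi y) ->
  (forall t, a <= t -> t <= b -> ~ B t -> forall e : R, 0 < e ->
    exists2 rho : R, 0 < rho &
    forall x y, a <= x -> x <= t -> t <= y -> y <= b -> t - rho < x -> y < t + rho ->
      `|gamma y - gamma x| <= Phi y - Phi x + e * (y - x)) ->
  (forall d : R, 0 < d -> exists M : R -> R,
    [/\ forall x y, a <= x -> x <= y -> y <= b -> M x <= M y, M b - M a < d &
    forall t, a <= t -> t <= b -> B t -> exists2 rho : R, 0 < rho &
    forall x y, a <= x -> x <= t -> t <= y -> y <= b -> t - rho < x -> y < t + rho ->
      y - x <= M y - M x]) ->
  `|gamma b - gamma a| <= Phi b - Phi a.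
Proof.
move=> ab ac Phi_nd good bad.
apply/ler_addgt0Pr => e e0.
pose e1 : R := e / 2 / (b - a + 1).
have ba1 : 0 < b - a + 1 by rewrite ltr_wpDl// subr_ge0.
have e10 : 0 < e1 by rewrite !divr_gt0.
have e20 : 0 < e / 2 by rewrite divr_gt0.
have [d d0 dP] := abs_continuous_chain ac e20.
have [M [M_nd Md Mbad]] := bad d d0.
(* [s] collects the intervals tagged by points of [B]; all the others are charged to [Phi], at the
   price of [e1] times their length. *)
pose P x y := exists s, [/\ itv_chain x s y,
   \sum_(p <- s) (p.2 - p.1) <= M y - M x &
   `|gamma y - gamma x| <= Phi y - Phi x + e1 * (y - x)
      + \sum_(p <- s) `|gamma p.2 - gamma p.1|].
have : P a b.
  apply: interval_induction => //.
    move=> x y z ax xy yz zb [s [cs ds bs]] [s' [cs' ds' bs']].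
    exists (s ++ s'); split; first exact: itv_chain_cat cs cs'.
      rewrite big_cat/=; apply: le_trans (lerD ds ds') _.
      by rewrite addrC addrA subrK.
    rewrite big_cat/= -(subrKA (gamma y)).
    apply: le_trans (ler_normD _ _) _; apply: le_trans (lerD bs' bs) _.
    rewrite le_eqVlt; apply/orP; left; apply/eqP; ring.
  move=> t at0 tb; have [Bt|nBt] := pselect (B t).
    have [rho rho0 Q] := Mbad t at0 tb Bt; exists rho => // x y ax xt ty yb tx yt.
    exists [:: (x, y)]; split=> /=; first by split=> //; exact: le_trans ty.
      by rewrite big_seq1; exact: Q.
    rewrite big_seq1 /= lerDr addr_ge0 ?subr_ge0//.
      by apply: Phi_nd => //; exact: le_trans ty.
    apply: mulr_ge0; first exact: ltW.
    by rewrite subr_ge0; exact: le_trans ty.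
  have [rho rho0 Q] := good t at0 tb nBt _ e10.
  exists rho => // x y ax xt ty yb tx yt; exists [::]; split=> /=.
  - exact: le_trans ty.
  - by rewrite big_nil subr_ge0; apply: M_nd => //; exact: le_trans ty.
  - by rewrite big_nil addr0; exact: Q.
move=> [s [cs ds bs]]; apply: le_trans bs _; rewrite -addrA lerD2l (splitr e).
apply: lerD; last by apply/ltW/dP => //; exact: le_lt_trans ds Md.
rewrite /e1 mulrAC ler_pdivrMr//; apply: ler_wpM2l; first exact: ltW.
by rewrite lerDl.
Qed.

(** As [t] lies between [x] and [y], the lengths [t - x] and [y - t] add up to [y - x]. The first
    order errors of [gamma] and of [Phi] then cost e/2 times [y - x] each. *)
Lemma is_derive_gauge (V : normedModType R) (gamma : R -> V) (Phi : R -> R) t v g :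
  is_derive t (1 : R) gamma v -> is_derive t (1 : R) Phi g -> `|v| <= g ->
  forall e : R, 0 < e -> exists2 rho : R, 0 < rho & forall x y,
    x <= t -> t <= y -> t - rho < x -> y < t + rho ->
    `|gamma y - gamma x| <= Phi y - Phi x + e * (y - x).
Proof.
move=> dg dPhi vg e e0; have e2 : 0 < e / 2 by rewrite divr_gt0.
have [d1 d10 P1] := (cvg_dnbhs0P _ _).1 ((is_derive1_cvg _ _ _).1 dg) _ e2.
have [d2 d20 P2] := (cvg_dnbhs0P _ _).1 ((is_derive1_cvg _ _ _).1 dPhi) _ e2.
have Q1 s : `|s - t| < d1 -> `|gamma s - gamma t| <= (g + e / 2) * `|s - t|.
  move=> sd; have [->|st] := eqVneq s t; first by rewrite !subrr !normr0 mulr0.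
  have st0 : s - t != 0 by rewrite subr_eq0.
  have := P1 _ st0 sd; rewrite subrK => H.
  have : `|(s - t)^-1 *: (gamma s - gamma t)| <= g + e / 2.
    rewrite -[X in `|X|](subrK v); apply: le_trans (ler_normD _ _) _.
    by rewrite addrC lerD.
  by rewrite normrZ normfV ler_pdivrMl ?normr_gt0// mulrC.
have Q2 s : `|s - t| < d2 -> `|Phi s - Phi t - (s - t) * g| <= e / 2 * `|s - t|.
  move=> sd; have [->|st] := eqVneq s t.
    by rewrite !subrr mul0r subrr !normr0 mulr0.
  have st0 : s - t != 0 by rewrite subr_eq0.
  have := P2 _ st0 sd; rewrite subrK => H.
  have -> : Phi s - Phi t - (s - t) * g = ((s - t)^-1 *: (Phi s - Phi t) - g) * (s - t).
    have -> : (s - t)^-1 *: (Phi s - Phi t) = (s - t)^-1 * (Phi s - Phi t) by [].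
    by rewrite [RHS]mulrBl mulrAC mulVf// mul1r (mulrC g).
  by rewrite normrM ler_wpM2r.
exists (Num.min d1 d2); first by rewrite lt_min d10.
move=> x y xt ty; rewrite ltrBlDr -ltrBlDl lt_min => /andP[x1 x2].
rewrite -ltrBlDl lt_min => /andP[y1 y2].
have xE : `|x - t| = t - x by rewrite distrC ger0_norm// subr_ge0.
have yE : `|y - t| = y - t by rewrite ger0_norm// subr_ge0.
have := Q1 x; have := Q1 y; have := Q2 x; have := Q2 y; rewrite !xE !yE.
move=> /(_ y2) A1 /(_ x2) A2 /(_ y1) A3 /(_ x1) A4.
have : `|gamma y - gamma x| <= `|gamma y - gamma t| + `|gamma x - gamma t|.
  by rewrite -(subrKA (gamma t)) (distrC (gamma x)); exact: ler_normD.
move: A1 A2; rewrite !ler_norml => /andP[A1 _] /andP[_ A2].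
move: A1 A2 A3 A4.
have E1 : e / 2 * (t - x) + e / 2 * (y - t) = e / 2 * (y - x) by ring.
have E2 : e * (y - x) = e / 2 * (y - x) + e / 2 * (y - x) by field.
have E3 : (g + e / 2) * (y - t) = g * (y - t) + e / 2 * (y - t) by ring.
have E4 : (g + e / 2) * (t - x) = g * (t - x) + e / 2 * (t - x) by ring.
have E5 : (x - t) * g = - (g * (t - x)) by ring.
have E6 : (y - t) * g = g * (y - t) by ring.
rewrite E2 E3 E4 E5 E6.
move: E1; move: (e / 2 * (t - x)) (e / 2 * (y - t)) (e / 2 * (y - x)) (g * (y - t)) (g * (t - x)).
move=> *; lra.
Qed.

End gauge.

(** * Increments of absolutely continuous curves bounded by integrals *)

Section absolutely_continuous_curves.
Context {R : realType}.
Local Notation mu := (@lebesgue_measure R).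

Lemma measurable_affine (c d : R) : measurable_fun setT (fun t : R => c * t + d).
Proof. by apply: measurable_funD => //; apply: measurable_funM. Qed.

(** Outer regularity encloses [B] in an open set U of measure below [d], and [M x] is the measure of
    the part of U in ]a, x]. Near a point of [B] all short intervals lie in U, so [M] grows there at
    unit rate. *)
Lemma lebesgue_negligible_gauge (B : set R) (a b : R) : a <= b -> mu.-negligible B ->
  forall d : R, 0 < d -> exists M : R -> R,
    [/\ forall x y, a <= x -> x <= y -> y <= b -> M x <= M y, M b - M a < d &
    forall t, a <= t -> t <= b -> B t -> exists2 rho : R, 0 < rho &
    forall x y, a <= x -> x <= t -> t <= y -> y <= b -> t - rho < x -> y < t + rho ->
      y - x <= M y - M x].
Proof.
move=> ab [N [mN N0 BN]] d d0.
have [|U [oU NU Ud]] := @lebesgue_regularity_outer R N d mN _ d0.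
  exact: (eq_ind_r (fun z => (z < +oo)%E) (ltry 0) N0).
have mU : measurable U by exact: open_measurable.
have Ulty : (mu U < d%:E)%E.
  rewrite (measureDI mu mU mN); apply: le_lt_trans Ud.
  rewrite -[leRHS]adde0 leeD2l// -N0.
  by apply: le_measure; rewrite ?inE//; exact: measurableI.
pose I x y := U `&` [set` `]x, y]%R].
have mI x y : measurable (I x y) by exact: measurableI.
have Ifin x y : mu (I x y) \is a fin_num.
  rewrite ge0_fin_numE//; apply: le_lt_trans (ltry d); apply: le_trans (ltW Ulty).
  exact: measureIl.
have Iadd x y z : x <= y -> y <= z -> (mu (I x z) = mu (I x y) + mu (I y z))%E.
  move=> xy yz; rewrite -measureU; [|exact: mI|exact: mI|].
    congr (mu _); rewrite -setIUr; congr (U `&` _).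
    by rewrite -itv_bndbnd_setU// bnd_simp.
  apply/seteqP; split=> // t [[_ /= h1] [_ /= h2]]; move: h1 h2; rewrite !in_itv/=.
  by move=> /andP[_ ty] /andP[]; rewrite ltNge ty.
pose M x := fine (mu (I a x)).
have ME x y : a <= x -> x <= y -> M y - M x = fine (mu (I x y)).
  by move=> ax xy; rewrite /M (Iadd a x y)// fineD// addrC addKr.
exists M; split.
- move=> x y ax xy yb; rewrite -subr_ge0 ME//; exact: fine_ge0.
- rewrite ME// -lte_fin fineK//; apply: le_lt_trans Ulty.
  exact: measureIl.
- move=> t at0 tb Bt; have /nbhs_ballP[rho rho0 rhoU] := open_nbhs_nbhs (conj oU (NU t (BN t Bt))).
  exists rho => // x y ax xt ty yb tx yt; rewrite ME//; last exact: le_trans ty.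
  have -> : I x y = [set` `]x, y]%R].
    apply/seteqP; split=> [s []//|s /= sxy]; split=> //; apply: rhoU.
    move: sxy; rewrite in_itv/= -ball_normE/= => /andP[xs sy].
    rewrite ltr_norml; apply/andP; split; lra.
  rewrite lebesgue_measure_itv/= lte_fin; case: ifPn => [xy|].
    by rewrite -EFinB.
  by rewrite -leNgt subr_le0.
Qed.

(** The primitive [Phi] of [g] has derivative [g] almost everywhere by Lebesgue differentiation. At
    such points [is_derive_gauge] compares [gamma] with [Phi], and the remaining null set is handled
    by [abs_continuous_gauge]. *)
Lemma abs_continuous_le_integral (V : normedModType R) (gamma : R -> V) (g : R -> R)
    (a b : R) : a <= b -> abs_continuous a b gamma ->
  mu.-integrable [set` `[a, b]] (EFin \o g) ->
  (forall t, a <= t -> t <= b -> 0 <= g t) ->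
  {ae mu, forall t, t \in `]a, b[ ->
    exists2 v, is_derive t (1 : R) gamma v & `|v| <= g t} ->
  `|gamma b - gamma a| <= \int[mu]_(t in [set` `[a, b]]) g t.
Proof.
move=> ab ac ig g0 dg.
pose h := g \_ [set` `[a, b]].
have h0 t : 0 <= h t.
  rewrite /h patchE; case: ifPn => // /set_mem/=; rewrite in_itv/= => /andP[].
  exact: g0.
have ih : mu.-integrable setT (EFin \o h).
  rewrite /h -restrict_EFin.
  exact: (proj1 (@integrable_mkcond _ (measurableTypeR R) R mu _ _ (measurable_itv `[a, b])) ig).
have ihS (D : set R) : measurable D -> mu.-integrable D (EFin \o h).
  by move=> mD; apply: integrableS ih.
pose Phi x := \int[mu]_(t in [set` `]-oo, x]]) h t.
have PhiB x y : x <= y -> Phi y - Phi x = \int[mu]_(t in [set` `]x, y]]) h t.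
  move=> xy; rewrite /Phi Rintegral_itvB ?bnd_simp//; exact: ihS.
have -> : \int[mu]_(t in [set` `[a, b]]) g t = Phi b - Phi a.
  rewrite PhiB// Rintegral_itv_obnd_cbnd; last exact: ihS.
  by apply: eq_Rintegral => t tab; rewrite /h patchE tab.
have lih : locally_integrable setT h by apply: open_integrable_locally => //; exact: openT.
have F1 := @FTC1Ny R h (fun y => ihS _ (measurable_itv _)) lih.
pose good t := t \in `]a, b[ -> (exists2 v, is_derive t (1 : R) gamma v & `|v| <= g t) /\
   is_derive t (1 : R) Phi (g t).
have gd : {ae mu, forall t, good t}.
  apply: (@filterS2 _ _ (ae_filter_ringOfSetsType mu) _ _ _ _ dg F1) => t dt Ft tab.
  split; first exact: dt.
  have := tab; rewrite in_itv/= => /andP[at0 tb].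
  have [D E] := Ft.
  split; first exact: D.
  by rewrite -derive1E E /h patchE mem_set//= in_itv/= !ltW.
(* The endpoints are declared exceptional because the derivatives are known only on the open
   interval. *)
pose B := ~` [set t | good t] `|` ([set a] `|` [set b]).
apply: (@abs_continuous_gauge R V gamma Phi a b B) => //.
- move=> x y ax xy yb; rewrite -subr_ge0 PhiB//; apply: Rintegral_ge0 => t _.
  exact: h0.
- move=> t at0 tb nBt e e0.
  have ta : t != a by apply/eqP => ta; apply: nBt; right; left.
  have tb' : t != b by apply/eqP => tb'; apply: nBt; right; right.
  have tab : t \in `]a, b[ by rewrite in_itv/= !lt_neqAle eq_sym ta at0 tb' tb.
  have gt : good t by apply: contrapT => ngt; apply: nBt; left.
  have [[v dv vg] dPhi] := gt tab.
  have [rho rho0 Q] := is_derive_gauge dv dPhi vg e0.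
  by exists rho => // x y _ xt ty _ tx yt; exact: Q.
- apply: lebesgue_negligible_gauge => //.
  apply: negligibleU; first exact: gd.
  by apply: negligibleU; apply/negligibleP => //; exact: lebesgue_measure_set1.
Qed.

End absolutely_continuous_curves.

(** * Affine changes of variable for Lebesgue measure *)

Section affine_substitution.
Context {R : realType}.
Local Notation mu := (@lebesgue_measure R).
Context (c d : R) (c0 : c != 0).
Local Notation phi := (fun t : R => c * t + d).

(** The right-hand side is a measure in [A] that agrees with Lebesgue measure on the intervals ]x,
    y]; uniqueness concludes. For c < 0 the preimage is open at its other end, which leaves the
    length unchanged. *)
Lemma lebesgue_measure_affine (A : set R) : measurable A ->
  (mu A = `|c|%:E * mu (phi @^-1` A))%E.
Proof.
have mphi : measurable_fun [set: measurableTypeR R] (phi : measurableTypeR R -> measurableTypeR R).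
  exact: measurable_affine.
pose m' : {measure set (measurableTypeR R) -> \bar R} :=
  mscale (NngNum (normr_ge0 c)) (pushforward mu (phi : measurableTypeR R -> measurableTypeR R)).
pose m := m' mphi.
move=> mA; rewrite -[RHS]/(m A).
apply: lebesgue_measure_unique => //= _ [[x y]] _ <-.
rewrite /m /m' /mscale/= /pushforward.
have [cpos|cneg|/esym cz] := ltgtP 0 c; last by move: c0; rewrite cz eqxx.
  have -> : phi @^-1` [set` `]x, y]] = [set` `](x - d) / c, (y - d) / c]].
    by apply/seteqP; split=> t /=; rewrite !in_itv/= ltr_pdivrMr// ler_pdivlMr// ltrBlDr lerBrDr mulrC.
  rewrite !lebesgue_measure_itv/= !lte_fin ltr_pM2r ?invr_gt0// ltrD2r.
  case: ifP => xy; last by rewrite mule0.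
  rewrite -!EFinB -EFinM gtr0_norm// -mulrBl mulrCA divff ?gt_eqF// mulr1.
  by congr (_%:E); ring.
have -> : phi @^-1` [set` `]x, y]] = [set` `[(y - d) / c, (x - d) / c[].
  by apply/seteqP; split=> t /=; rewrite !in_itv/= ltr_ndivlMr// ler_ndivrMr// ltrBlDr lerBrDr mulrC andbC.
rewrite !lebesgue_measure_itv/= !lte_fin ltr_nM2r ?invr_lt0// ltrD2r.
case: ifP => xy; last by rewrite mule0.
rewrite -!EFinB -EFinM ltr0_norm// -mulrBl mulNr mulrCA divff ?lt_eqF// mulr1.
by congr (_%:E); ring.
Qed.

Lemma negligible_affine (N : set R) : mu.-negligible N -> mu.-negligible (phi @^-1` N).
Proof.
move=> [A [mA A0 NA]]; exists (phi @^-1` A); split.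
- by rewrite -[X in measurable X]setTI; exact: measurable_affine.
- have := lebesgue_measure_affine mA; rewrite A0 => /esym/eqP.
  by rewrite mule_eq0 eqe normr_eq0 (negbTE c0)/= => /eqP.
- by move=> t; exact: NA.
Qed.

Lemma ge0_integral_affine (D : set R) (h : measurableTypeR R -> \bar R) : measurable D ->
  measurable_fun D h -> (forall t, D t -> (0 <= h t)%E) ->
  (\int[mu]_(t in D) h t = `|c|%:E * \int[mu]_(t in phi @^-1` D) h (phi t))%E.
Proof.
move=> mD mh h0.
have mphi : measurable_fun [set: measurableTypeR R] (phi : measurableTypeR R -> measurableTypeR R).
  exact: measurable_affine.
pose m' : {measure set (measurableTypeR R) -> \bar R} :=
  mscale (NngNum (normr_ge0 c)) (pushforward mu (phi : measurableTypeR R -> measurableTypeR R)).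
pose m := m' mphi.
rewrite (@eq_measure_integral _ _ _ _ m); last first.
  by move=> A mA _; exact: lebesgue_measure_affine.
rewrite ge0_integral_mscale//= ge0_integral_pushforward//.
by move=> t /set_mem; exact: h0.
Qed.

Lemma integrable_affine (D : set R) (h : R -> R) : measurable D ->
  mu.-integrable D (EFin \o h) ->
  mu.-integrable (phi @^-1` D) (EFin \o (h \o phi)).
Proof.
move=> mD /integrableP[mh ih].
have mpD : measurable (phi @^-1` D).
  by rewrite -[X in measurable X]setTI; exact: measurable_affine.
apply/integrableP; split.
  apply: (measurable_comp mD) mh _; first by move=> _ [t + <-].
  exact: measurable_funTS (measurable_affine c d).
have := @ge0_integral_affine D (fun t => `|(h t)%:E|)%E mD.
move=> /(_ (measurableT_comp _ mh) (fun _ _ => abse_ge0 _)) E.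
move: ih; rewrite /= E //.
rewrite -[X in _ -> (X < _)%E]mul1e -(@mulVf _ `|c|) ?normr_eq0//.
rewrite EFinM -muleA => H.
by rewrite lte_mul_pinfty// lee_fin invr_ge0.
Qed.

End affine_substitution.

(** * Operations on absolutely continuous curves *)

Section abs_continuous_theory.
Context {R : realType}.

Lemma abs_continuous_sub (V : normedModType R) (a b a' b' : R) (g : R -> V) :
  a <= a' -> b' <= b -> abs_continuous a b g -> abs_continuous a' b' g.
Proof.
move=> aa bb gac e /gac[d d0 dP]; exists d => // N l r lr tI s.
by apply: dP => // k; have [al [lrk rb]] := lr k; rewrite lrk (le_trans aa)// (le_trans rb).
Qed.

Lemma abs_continuous_eq (V : normedModType R) (a b : R) (g g' : R -> V) :
  (forall t, a <= t -> t <= b -> g t = g' t) ->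
  abs_continuous a b g -> abs_continuous a b g'.
Proof.
move=> gg gac e /gac[d d0 dP]; exists d => // N l r lr tI s.
rewrite (eq_bigr (fun k => `|g (r k) - g (l k)|)); first exact: dP.
move=> k _; have [al [lrk rb]] := lr k.
by rewrite !gg// ?(le_trans lrk)// (le_trans al).
Qed.

Lemma abs_continuousD (V : normedModType R) (a b : R) (g g' : R -> V) :
  abs_continuous a b g -> abs_continuous a b g' ->
  abs_continuous a b (fun t => g t + g' t).
Proof.
move=> gac gac' e e0; have e2 : 0 < e / 2 by rewrite divr_gt0.
have [d d0 dP] := gac _ e2; have [d' d'0 d'P] := gac' _ e2.
exists (Num.min d d'); first by rewrite lt_min d0.
move=> N l r lr tI; rewrite lt_min => /andP[sd sd'].
rewrite (splitr e); apply: le_lt_trans (ltrD (dP _ _ _ lr tI sd) (d'P _ _ _ lr tI sd')).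
rewrite -big_split/=; apply: ler_sum => k _.
by rewrite opprD addrACA; exact: ler_normD.
Qed.

Lemma abs_continuous_shift (V : normedModType R) (a b : R) (g : R -> V) (c : V) :
  abs_continuous a b g -> abs_continuous a b (fun t => g t + c).
Proof.
move=> gac e /gac[d d0 dP]; exists d => // N l r lr tI s.
rewrite (eq_bigr (fun k => `|g (r k) - g (l k)|)); first exact: dP.
by move=> k _; rewrite opprD addrACA subrr addr0.
Qed.

Lemma abs_continuous_lipschitz (V W : normedModType R) (a b K : R) (g : R -> V)
    (F : V -> W) : 0 <= K -> abs_continuous a b g ->
  (forall s t, a <= s <= b -> a <= t <= b -> `|F (g s) - F (g t)| <= K * `|g s - g t|) ->
  abs_continuous a b (F \o g).
Proof.
move=> K0 gac FK e e0.
have K1 : 0 < K + 1 by rewrite ltr_wpDl.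
have [d d0 dP] := gac _ (divr_gt0 e0 K1).
exists d => // N l r lr tI s; have := dP _ _ _ lr tI s.
rewrite ltr_pdivlMr// => H; apply: le_lt_trans H; rewrite mulr_suml.
apply: ler_sum => k _; have [al [lrk rb]] := lr k.
apply: (le_trans (FK _ _ _ _)).
- by rewrite rb (le_trans al).
- by rewrite al (le_trans lrk).
- by rewrite mulrC ler_wpM2l// lerDl.
Qed.

Lemma abs_continuous_increment (V : normedModType R) (a b : R) (g : R -> V) :
  abs_continuous a b g -> forall e : R, 0 < e -> exists2 d : R, 0 < d &
  forall s t, a <= s <= b -> a <= t <= b -> `|s - t| < d -> `|g s - g t| < e.
Proof.
move=> gac e /gac[d d0 dP]; exists d => // s t sab tab.
wlog st : s t sab tab / s <= t.
  move=> H; have [st|ts] := leP s t; first exact: H.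
  by rewrite distrC (distrC (g s)); apply: H => //; exact: ltW.
move=> std.
have := dP 1%N (fun=> s) (fun=> t); rewrite !big_ord1 distrC; apply.
- by move=> _; case/andP: sab; case/andP: tab.
- by move=> i j _ _ _; rewrite !ord1.
- by apply: le_lt_trans std; rewrite distrC ler_norm.
Qed.

(** Clamping time to [a, b] by the 1-Lipschitz map [cl] yields a curve continuous on the whole line,
    to which the extreme value theorem applies. *)
Lemma abs_continuous_bounded (V : normedModType R) (a b : R) (g : R -> V) :
  a <= b -> abs_continuous a b g ->
  exists M : R, forall t, a <= t <= b -> `|g t| <= M.
Proof.
move=> ab gac; pose cl (t : R) : R := Num.max a (Num.min t b).
have clab t : a <= cl t <= b.
  by rewrite le_max lexx/= ge_max ab ge_min lexx orbT.
have clE t : a <= t <= b -> cl t = t.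
  by move=> /andP[at0 tb]; rewrite /cl (min_idPl tb) (max_idPr at0).
have cl_lip s t : `|cl s - cl t| <= `|s - t|.
  have tri (z x y : R) : x - y <= z -> y - x <= z -> `|x - y| <= z.
    by move=> h1 h2; rewrite ler_norml h1 andbT lerNl opprB.
  have H1 (x y : R) : x - y <= `|x - y| := ler_norm _.
  have H2 (x y : R) : y - x <= `|x - y| by rewrite distrC ler_norm.
  apply: (@le_trans _ _ `|Num.min s b - Num.min t b|); apply: tri.
  - have := H1 (Num.min s b) (Num.min t b); have := normr_ge0 (Num.min s b - Num.min t b).
    rewrite /cl; case: (leP a (Num.min s b)) => ?; case: (leP a (Num.min t b)) => ? *; lra.
  - have := H2 (Num.min s b) (Num.min t b); have := normr_ge0 (Num.min s b - Num.min t b).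
    rewrite /cl; case: (leP a (Num.min s b)) => ?; case: (leP a (Num.min t b)) => ? *; lra.
  - have := H1 s t; have := normr_ge0 (s - t).
    case: (leP s b) => ?; case: (leP t b) => ? *; lra.
  - have := H2 s t; have := normr_ge0 (s - t).
    case: (leP s b) => ?; case: (leP t b) => ? *; lra.
have [|c _ cP] := @EVT_max R (fun t => `|g (cl t)|) a b ab.
  apply: continuous_subspaceT => t; apply/continuous_atP => e e0.
  have [d d0 dP] := abs_continuous_increment gac e0.
  exists d => // s sd; apply: le_trans (ler_dist_dist _ _) _; apply/ltW.
  by apply: dP => //; exact: le_lt_trans (cl_lip s t) sd.
exists `|g (cl c)| => t tab.
by have := cP t; rewrite in_itv/= clE//; apply.
Qed.

Lemma abs_continuous_reparam (V : normedModType R) (a b a' b' K : R) (g : R -> V)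
    (phi : R -> R) : 0 <= K -> {homo phi : s t / s <= t} ->
  (forall s t, `|phi s - phi t| <= K * `|s - t|) ->
  (forall t, a <= t <= b -> a' <= phi t <= b') ->
  abs_continuous a' b' g -> abs_continuous a b (g \o phi).
Proof.
move=> K0 phi_nd phi_lip phi_ab gac e /gac[d d0 dP].
have K1 : 0 < K + 1 by rewrite ltr_wpDl.
exists (d / (K + 1)); first exact: divr_gt0.
move=> N l r lr tI; rewrite ltr_pdivlMr// => s; apply: dP.
- move=> k; have [al [lrk rb]] := lr k.
  have /andP[? ?] : a' <= phi (l k) <= b' by apply: phi_ab; rewrite al (le_trans lrk).
  have /andP[? ?] : a' <= phi (r k) <= b' by apply: phi_ab; rewrite rb (le_trans al).
  by split=> //; split=> //; exact: phi_nd.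
(* Disjointness passes to the images under a map that is only nondecreasing: a common point of two
   image intervals forces the original intervals to overlap, and the midpoint of their intersection
   is a witness. *)
- move=> i j _ _ [p [/=]]; rewrite !in_itv/= => /andP[li ri] /andP[lj rj].
  have mono x y : phi x < phi y -> x < y by apply: contraTT; rewrite -!leNgt; exact: phi_nd.
  have lri := mono _ _ (lt_trans li ri); have lrj := mono _ _ (lt_trans lj rj).
  have lij := mono _ _ (lt_trans li rj); have lji := mono _ _ (lt_trans lj ri).
  apply: (tI i j I I).
  exists ((Num.max (l i) (l j) + Num.min (r i) (r j)) / 2) => /=.
  have [m1 m2] : Num.max (l i) (l j) < Num.min (r i) (r j) /\ True.
    by split=> //; rewrite lt_min !gt_max lri lji lij lrj.
  have [h1 h2] := midf_lt m1.
  move: h1 h2; rewrite gt_max lt_min => /andP[? ?] /andP[? ?].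
  by split=> /=; rewrite in_itv/=; apply/andP.
- apply: le_lt_trans s; rewrite mulr_suml; apply: ler_sum => k _.
  have [al [lrk rb]] := lr k; apply: le_trans (ler_norm _) _.
  apply: le_trans (phi_lip _ _) _; rewrite ger0_norm ?subr_ge0// mulrC.
  by rewrite ler_wpM2l ?subr_ge0// lerDl.
Qed.

Lemma abs_continuous_reverse (V : normedModType R) (a b : R) (g : R -> V) :
  abs_continuous a b g -> abs_continuous a b (fun t => g (a + b - t)).
Proof.
move=> gac e /gac[d d0 dP]; exists d => // N l r lr tI s.
have := dP N (fun k => a + b - r k) (fun k => a + b - l k).
have E k : a + b - l k - (a + b - r k) = r k - l k by ring.
rewrite (eq_bigr _ (fun k _ => E k)).
have -> : \sum_(k < N) `|g (a + b - r k) - g (a + b - l k)| =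
    \sum_(k < N) `|g (a + b - l k) - g (a + b - r k)|.
  by apply: eq_bigr => k _; rewrite distrC.
apply=> // [k|i j _ _ [p [/=]]].
  by have [al [lrk rb]] := lr k; split; [lra|split; lra].
rewrite !in_itv/= => /andP[li ri] /andP[lj rj].
by apply: (tI i j I I); exists (a + b - p); split; rewrite /= in_itv/=; apply/andP; split; lra.
Qed.

Lemma is_derive_affine (V : normedModType R) (c d t : R) (g : R -> V) v :
  is_derive (c * t + d) (1 : R) g v ->
  is_derive t (1 : R) (fun s => g (c * s + d)) (c *: v).
Proof.
move=> /is_derive1_cvg/cvg_dnbhs0P gv; apply/is_derive1_cvg/cvg_dnbhs0P => e e0.
have [->|c0] := eqVneq c 0.
  exists 1 => // s _ _; rewrite !mul0r subrr scaler0 scale0r subrr normr0.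
  exact: ltW.
have cn0 : 0 < `|c| by rewrite normr_gt0.
have [r r0 rP] := gv _ (divr_gt0 e0 cn0).
exists (r / `|c|); first exact: divr_gt0.
move=> s s0; rewrite ltr_pdivlMr// -normrM mulrC => sr.
have := rP (c * s) (mulf_neq0 c0 s0) sr.
have -> : c * s + (c * t + d) = c * (s + t) + d by ring.
move: (g (c * (s + t) + d) - g (c * t + d)) => D.
rewrite ler_pdivlMr// mulrC -normrZ scalerBr scalerA.
by rewrite invfM mulrA mulfV// mul1r.
Qed.

End abs_continuous_theory.

(** * Horizontal curves and the distance *)

Section horizontal_curves.
Context {R : realType} {n : nat} (G : carnot_group R n).
Local Notation mul := (cg_mul G).
Local Notation inv := (cg_inv G).
Local Notation deg := (cg_deg G).
Local Notation X := (cg_field G).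
Local Notation dil := (dilation G).
Local Notation mu := (@lebesgue_measure R).
Implicit Types (x y z w : 'rV[R]_n) (g : R -> 'rV[R]_n) (u : 'I_n -> R -> R).

Definition control u (t : R) : 'rV[R]_n :=
  \row_j (if deg j == 1%N then u j t else 0).

Definition speed u (t : R) : R :=
  Num.sqrt (\sum_(j < n | deg j == 1%N) u j t ^+ 2).

Lemma hlengthE a b u : hlength G a b u = \int[mu]_(t in [set` `[a, b]]) speed u t.
Proof. by []. Qed.

Lemma control_lfield u t p :
  \sum_(j < n | deg j == 1%N) u j t *: X j p = cg_lfield G (control u t) p.
Proof.
rewrite big_mkcond/=; apply: eq_bigr => j _; rewrite mxE.
by case: ifP => // _; rewrite scale0r.
Qed.

Lemma derive_mul_lfield x a y : 'D_(cg_lfield G a y) (mul x) y = cg_lfield G a (mul x y).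
Proof.
rewrite (derive_dir_sum y (a 0) (fun k => X k y) (smooth_mull G x)).
by under eq_bigr do rewrite -cg_field_mul.
Qed.

Lemma dilation_lfield t a p : t != 0 ->
  dil t (cg_lfield G a p) = cg_lfield G (dil t a) (dil t p).
Proof.
move=> t0; apply/rowP => j; rewrite [LHS]mxE !cg_lfieldE mulr_sumr.
apply: eq_bigr => k _.
by rewrite [dil t a 0 k]mxE mulrCA cg_field_dilation// mulrA (mulrC (a 0 k)).
Qed.

Lemma is_derive_dilation (t r : R) g v : is_derive r (1 : R) g v ->
  is_derive r (1 : R) (fun s => dil t (g s)) (dil t v).
Proof.
move=> [D E].
have H j : is_derive r (1 : R) (fun r => dil t (g r) 0 j) (t ^+ deg j * v 0 j).
  have := is_deriveZ (t ^+ deg j) (is_derive_coord j D); rewrite E.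
  have -> : (fun r => dil t (g r) 0 j) = t ^+ deg j *: (fun r : R => g r 0 j).
    by apply/funext => s; rewrite mxE.
  exact.
have D' : derivable (fun r => dil t (g r)) r 1.
  by apply/derivable_mxP => i j; rewrite ord1; case: (H j).
split; first exact: D'.
by apply/rowP => j; rewrite (derive_coord j D') mxE; have [_ ->] := H j.
Qed.

Lemma speed_ge0 u t : 0 <= speed u t.
Proof. exact: sqrtr_ge0. Qed.

Lemma control_le_speed u t j : deg j = 1%N -> `|u j t| <= speed u t.
Proof.
move=> dj; rewrite -sqrtr_sqr; apply: ler_wsqrtr.
rewrite (bigD1 j) ?dj//= lerDl sumr_ge0// => i _; exact: sqr_ge0.
Qed.

Lemma speed_le_sum u t : speed u t <= \sum_(j < n | deg j == 1%N) `|u j t|.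
Proof.
have S0 : 0 <= \sum_(j < n | deg j == 1%N) `|u j t| by exact: sumr_ge0.
rewrite -[leRHS]ger0_norm// -sqrtr_sqr; apply: ler_wsqrtr.
rewrite expr2 mulr_suml; apply: ler_sum => j dj.
rewrite -real_normK ?num_real// expr2 ler_wpM2l//.
by rewrite (bigD1 j)//= lerDl sumr_ge0.
Qed.

Lemma integrable_speed (a b : R) u :
  (forall j, deg j = 1%N -> mu.-integrable [set` `[a, b]] (EFin \o u j)) ->
  mu.-integrable [set` `[a, b]] (EFin \o speed u).
Proof.
move=> ui.
apply: (@le_integrable _ _ _ mu _ _ _
  (fun t => \sum_(j < n | deg j == 1%N) `|(u j t)%:E|)%E) => //.
- apply/measurable_EFinP.
  apply: (@measurableT_comp _ _ _ _ _ _ (@Num.sqrt R)).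
    by apply: continuous_measurable_fun; exact: sqrt_continuous.
  have -> : (fun t => \sum_(j < n | deg j == 1%N) u j t ^+ 2) =
     (fun t => \sum_(j < n) (if deg j == 1%N then u j t ^+ 2 else 0)).
    by apply/funext => t; rewrite big_mkcond.
  apply: measurable_sum => j; case: eqP => [dj|_]; last exact: measurable_cst.
  apply: measurable_funX; apply/measurable_EFinP.
  exact: measurable_int (ui j dj).
- move=> t _; rewrite gee0_abs ?lee_fin ?speed_ge0//.
  rewrite gee0_abs; last by apply: sume_ge0 => j _; exact: abse_ge0.
  by rewrite /= sumEFin lee_fin speed_le_sum.
- apply: integrable_sum => // j /eqP dj; exact: integrable_abse (ui j dj).
Qed.

Lemma integrable_scale (D : set R) (k : R) (h : R -> R) : measurable D ->
  mu.-integrable D (EFin \o h) -> mu.-integrable D (EFin \o (fun t => k * h t)).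
Proof.
move=> mD hi; have := @integrableZl _ (measurableTypeR R) R mu D mD k _ hi.
by apply: eq_integrable => // t _ /=; rewrite EFinM.
Qed.

Lemma horizontal_mul a b x g u : a <= b ->
  horizontal G a b g u -> horizontal G a b (fun t => mul x (g t)) u.
Proof.
move=> ab [gac ui gd]; split; [|exact: ui|].
  have [M MP] := abs_continuous_bounded ab gac.
  have [K K0 KP] := smooth_lipschitz_on_ball M (smooth_mull G x).
  apply: (abs_continuous_lipschitz (F := mul x) K0 gac) => s t sab tab.
  by apply: KP; exact: MP.
apply: (@filterS _ _ (ae_filter_ringOfSetsType mu) _ _ _ gd) => t gt tab.
have := is_derive_comp_curve_rV (smooth_mull G x) (gt tab).
by rewrite !control_lfield derive_mul_lfield.
Qed.

Lemma dilation_control (t : R) u s :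
  dil t (control u s) = control (fun j s => t * u j s) s.
Proof.
apply/rowP => j; rewrite !mxE; case: ifP => [/eqP ->|_]; last by rewrite mulr0.
by rewrite expr1.
Qed.

Lemma horizontal_dilation a b (t : R) g u : t != 0 -> horizontal G a b g u ->
  horizontal G a b (fun s => dil t (g s)) (fun j s => t * u j s).
Proof.
move=> t0 [gac ui gd]; split.
- have [K K0 KP] := dilation_norm_le_gen G t.
  apply: (abs_continuous_lipschitz (F := dil t) K0 gac) => r s _ _.
  by rewrite -dilationB; exact: KP.
- by move=> j dj; exact: (integrable_scale t (measurable_itv `[a, b]) (ui j dj)).
- apply: (@filterS _ _ (ae_filter_ringOfSetsType mu) _ _ _ gd) => s gs sab.
  have E := control_lfield (fun j s => t * u j s) s (dil t (g s)).
  rewrite -dilation_control -dilation_lfield// -control_lfield in E.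
  by rewrite E; exact: (is_derive_dilation t (gs sab)).
Qed.

Lemma hlength_dilation a b (t : R) u :
  (forall j, deg j = 1%N -> mu.-integrable [set` `[a, b]] (EFin \o u j)) ->
  hlength G a b (fun j s => t * u j s) = `|t| * hlength G a b u.
Proof.
move=> ui; rewrite !hlengthE -RintegralZl//; last exact: integrable_speed.
apply: eq_Rintegral => s _; rewrite /speed.
under eq_bigr do rewrite exprMn.
by rewrite -mulr_sumr sqrtrM ?sqr_ge0// sqrtr_sqr.
Qed.

Lemma preimage_onem_itv (b1 b2 : bool) :
  (fun t : R => -1 * t + 1) @^-1` [set` Interval (BSide b1 0) (BSide b2 1)] =
  [set` Interval (BSide (~~ b2) 0) (BSide (~~ b1) 1)].
Proof.
apply/seteqP; split=> t /=; rewrite !in_itv/=; case: b1; case: b2 => /= /andP[h1 h2];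
  apply/andP; split; lra.
Qed.

Lemma speed_reverse u t :
  speed (fun j t => - u j (-1 * t + 1)) t = speed u (-1 * t + 1).
Proof. by rewrite /speed; under eq_bigr do rewrite sqrrN. Qed.

(** Reversed time is written [-1 * t + 1] to fit the pattern [c * t + d] of the affine lemmas;
    [2 * t + 0] and [2 * t + -1] below have the same origin. *)
Lemma horizontal_reverse g u : horizontal G 0 1 g u ->
  horizontal G 0 1 (fun t => g (-1 * t + 1)) (fun j t => - u j (-1 * t + 1)).
Proof.
move=> [gac ui gd].
have N10 : (-1 : R) != 0 by rewrite oppr_eq0 oner_eq0.
split.
- have := abs_continuous_reverse gac.
  have -> // : (fun t => g (0 + 1 - t)) = (fun t => g (-1 * t + 1)).
  by apply/funext => t; congr g; ring.
- move=> j dj; have := integrable_affine 1 N10 (measurable_itv `[0, 1]) (ui j dj).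
  rewrite preimage_onem_itv/= => ui'.
  have := integrable_scale (-1) (measurable_itv `[0, 1]) ui'.
  apply: eq_integrable => // t _ /=.
  by congr (_%:E); exact: mulN1r.
- have := negligible_affine 1 N10 gd; apply: negligibleS => t /=.
  move=> nt; apply: contra_not nt => gt tab.
  have tab' : -1 * t + 1 \in `]0, 1[.
    by move: tab; rewrite !in_itv/= => /andP[h1 h2]; apply/andP; split; lra.
  have := is_derive_affine (gt tab').
  rewrite scaleN1r; congr (is_derive _ _ _ _).
  by rewrite -sumrN; apply: eq_bigr => j _; rewrite scaleNr.
Qed.

Lemma hlength_reverse u :
  (forall j, deg j = 1%N -> mu.-integrable [set` `[0, 1]] (EFin \o u j)) ->
  hlength G 0 1 (fun j t => - u j (-1 * t + 1)) = hlength G 0 1 u.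
Proof.
move=> ui; rewrite !hlengthE /Rintegral; congr fine.
have N10 : (-1 : R) != 0 by rewrite oppr_eq0 oner_eq0.
have := @ge0_integral_affine R (-1) 1 N10 [set` `[0, 1]] (EFin \o speed u) (measurable_itv _).
rewrite normrN1 mul1e preimage_onem_itv/= => ->.
- by apply: eq_integral => t _; rewrite speed_reverse.
- exact: measurable_int (integrable_speed ui).
- by move=> t _; rewrite lee_fin speed_ge0.
Qed.

End horizontal_curves.

(** * Reachability and the Carnot-Caratheodory distance *)

Section carnot_caratheodory.
Context {R : realType} {n : nat} (G : carnot_group R n).
Local Notation mul := (cg_mul G).
Local Notation deg := (cg_deg G).
Local Notation X := (cg_field G).
Local Notation dil := (dilation G).
Local Notation d := (cc_dist G).
Local Notation mu := (@lebesgue_measure R).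
Implicit Types (x y z w : 'rV[R]_n) (g : R -> 'rV[R]_n) (u : 'I_n -> R -> R).

Definition reachable x y :=
  exists g u, [/\ horizontal G 0 1 g u, g 0 = x & g 1 = y].

(** The concatenation equals g1(min(2t, 1)) + g2(max(2t - 1, 0)) - g2(0), a sum of two monotone
    Lipschitz reparametrizations, so that no interval has to be cut at 1/2. *)
Lemma abs_continuous_cat g1 g2 : abs_continuous 0 1 g1 -> abs_continuous 0 1 g2 ->
  g1 1 = g2 0 -> abs_continuous 0 1
    (fun t => if t <= 2^-1 then g1 (2 * t + 0) else g2 (2 * t + -1)).
Proof.
move=> ac1 ac2 g12.
pose phi1 (t : R) : R := Num.min (2 * t) 1.
pose phi2 (t : R) : R := Num.max (2 * t - 1) 0.
have lip (phi : R -> R) : {homo phi : s t / s <= t} ->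
    (forall s t, s <= t -> phi t - phi s <= 2 * (t - s)) ->
    forall s t, `|phi s - phi t| <= 2 * `|s - t|.
  move=> ndphi phiB s t; wlog st : s t / s <= t.
    move=> H; have [|/ltW ts] := leP s t; first exact: H.
    by rewrite distrC (distrC s); exact: H.
  rewrite distrC ger0_norm ?subr_ge0; last exact: ndphi.
  by rewrite distrC ger0_norm ?subr_ge0// phiB.
have nd1 : {homo phi1 : s t / s <= t}.
  move=> s t st; rewrite /phi1.
  by case: (leP (2 * s) 1) => ?; case: (leP (2 * t) 1) => ?; lra.
have nd2 : {homo phi2 : s t / s <= t}.
  move=> s t st; rewrite /phi2.
  by case: (leP (2 * s - 1) 0) => ?; case: (leP (2 * t - 1) 0) => ?; lra.
have B1 : forall s t, s <= t -> phi1 t - phi1 s <= 2 * (t - s).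
  move=> s t st; rewrite /phi1.
  by case: (leP (2 * s) 1) => ?; case: (leP (2 * t) 1) => ?; lra.
have B2 : forall s t, s <= t -> phi2 t - phi2 s <= 2 * (t - s).
  move=> s t st; rewrite /phi2.
  by case: (leP (2 * s - 1) 0) => ?; case: (leP (2 * t - 1) 0) => ?; lra.
have I1 t : 0 <= t <= 1 -> 0 <= phi1 t <= 1.
  move=> /andP[t0 t1]; rewrite /phi1; case: (leP (2 * t) 1) => ?; apply/andP; split; lra.
have I2 t : 0 <= t <= 1 -> 0 <= phi2 t <= 1.
  move=> /andP[t0 t1]; rewrite /phi2; case: (leP (2 * t - 1) 0) => ?; apply/andP; split; lra.
have h1 := abs_continuous_reparam (ler0n R 2) nd1 (lip _ nd1 B1) I1 ac1.
have h2 := abs_continuous_reparam (ler0n R 2) nd2 (lip _ nd2 B2) I2 ac2.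
apply: abs_continuous_eq (abs_continuousD h1 (abs_continuous_shift (- g2 0) h2)).
move=> t t0 t1 /=; rewrite /phi1 /phi2; case: (leP t 2^-1) => ht.
  have -> : Num.min (2 * t) 1 = 2 * t + 0 by case: (leP (2 * t) 1) => ?; lra.
  have -> : Num.max (2 * t - 1) 0 = 0 by case: (leP (2 * t - 1) 0) => ?; lra.
  by rewrite subrr addr0.
have -> : Num.min (2 * t) 1 = 1 by case: (leP (2 * t) 1) => ?; lra.
have -> : Num.max (2 * t - 1) 0 = 2 * t + -1 by case: (leP (2 * t - 1) 0) => ?; lra.
by rewrite g12 addrC subrK.
Qed.

Lemma integrable_cat (h1 h2 : R -> R) :
  mu.-integrable [set` `[0, 1]] (EFin \o h1) -> mu.-integrable [set` `[0, 1]] (EFin \o h2) ->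
  mu.-integrable [set` `[0, 1]] (EFin \o
    (fun t => if t <= 2^-1 then 2 * h1 (2 * t + 0) else 2 * h2 (2 * t + -1))).
Proof.
move=> i1 i2.
have c0 : (2 : R) != 0 by rewrite pnatr_eq0.
have mI (i : interval R) : measurable [set` i] := measurable_itv i.
have j1 := integrable_affine 0 c0 (mI _) i1.
have j2 := integrable_affine (-1) c0 (mI _) i2.
have k1 : mu.-integrable [set` `[0, 2^-1]] (EFin \o (fun t => 2 * h1 (2 * t + 0))).
  apply: integrable_scale => //; apply: integrableS j1 => //.
    by rewrite -[X in measurable X]setTI; exact: measurable_affine.
  by move=> t /=; rewrite !in_itv/= => /andP[? ?]; apply/andP; split; lra.
have k2 : mu.-integrable [set` `]2^-1, 1]] (EFin \o (fun t => 2 * h2 (2 * t + -1))).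
  apply: integrable_scale => //; apply: integrableS j2 => //.
    by rewrite -[X in measurable X]setTI; exact: measurable_affine.
  by move=> t /=; rewrite !in_itv/= => /andP[? ?]; apply/andP; split; lra.
have l1 := proj1 (@integrable_mkcond _ (measurableTypeR R) R mu _ _ (mI _)) k1.
have l2 := proj1 (@integrable_mkcond _ (measurableTypeR R) R mu _ _ (mI _)) k2.
have l := @integrableD _ (measurableTypeR R) R mu _ measurableT _ _ l1 l2.
have l' := @integrableS _ (measurableTypeR R) R mu _ _ _ measurableT (mI `[0, 1]) (@subsetT _ _) l.
apply: eq_integrable l' => // t /set_mem/=; rewrite in_itv/= => /andP[t0 t1].
rewrite !patchE; case: (leP t 2^-1) => ht.
  rewrite mem_set/= ?in_itv/= ?t0// memNset/= ?adde0//.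
  by rewrite in_itv/= ltNge ht.
rewrite memNset/= ?in_itv/= ?t0 -?ltNge//= ?mem_set/= ?in_itv/= ?ht ?t1 ?add0e//.
by rewrite leNgt ht.
Qed.

Lemma reachable_trans y x z : reachable x y -> reachable y z -> reachable x z.
Proof.
move=> [g1 [u1 [[ac1 i1 d1] g10 g11]]] [g2 [u2 [[ac2 i2 d2] g20 g21]]].
have c0 : (2 : R) != 0 by rewrite pnatr_eq0.
exists (fun t => if t <= 2^-1 then g1 (2 * t + 0) else g2 (2 * t + -1)).
exists (fun j t => if t <= 2^-1 then 2 * u1 j (2 * t + 0) else 2 * u2 j (2 * t + -1)).
split; last first.
- have -> : (1 <= 2^-1 :> R) = false by apply/negbTE; rewrite -ltNge; lra.
  by have -> : 2 * 1 + -1 = 1 :> R by ring.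
- have -> : (0 <= 2^-1 :> R) by lra.
  by rewrite mulr0 addr0.
split.
- by apply: abs_continuous_cat => //; rewrite g11.
- by move=> j dj; exact: integrable_cat (i1 j dj) (i2 j dj).
have n1 := negligible_affine 0 c0 d1; have n2 := negligible_affine (-1) c0 d2.
(* At the junction the two one-sided velocities may differ, so this time joins the exceptional null
   set. *)
have n3 : mu.-negligible [set (2^-1 : R)].
  by apply/negligibleP => //; exact: lebesgue_measure_set1.
apply: negligibleS (negligibleU (negligibleU n1 n2) n3) => t /= nt.
apply: contrapT => /not_orP[/not_orP[/contrapT N1 /contrapT N2] N3].
apply: nt; rewrite in_itv/= => /andP[t0 t1].
have [ht|ht|/N3//] := ltgtP t 2^-1.
- have I : 2 * t + 0 \in `]0, 1[ by rewrite in_itv/=; apply/andP; split; lra.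
  have D := is_derive_affine (N1 I).
  have E : \sum_(j < n | deg j == 1%N) (2 * u1 j (2 * t + 0)) *: X j (g1 (2 * t + 0)) =
      2 *: \sum_(j < n | deg j == 1%N) u1 j (2 * t + 0) *: X j (g1 (2 * t + 0)).
    by rewrite scaler_sumr; apply: eq_bigr => j _; rewrite scalerA.
  rewrite E; apply: near_eq_is_derive D; near=> s; rewrite ifT//.
  by apply: ltW; near: s; exact: lt_nbhsl.
- have I : 2 * t + -1 \in `]0, 1[ by rewrite in_itv/=; apply/andP; split; lra.
  have D := is_derive_affine (N2 I).
  have E : \sum_(j < n | deg j == 1%N) (2 * u2 j (2 * t + -1)) *: X j (g2 (2 * t + -1)) =
      2 *: \sum_(j < n | deg j == 1%N) u2 j (2 * t + -1) *: X j (g2 (2 * t + -1)).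
    by rewrite scaler_sumr; apply: eq_bigr => j _; rewrite scalerA.
  rewrite E; apply: near_eq_is_derive D; near=> s; rewrite ifF//.
  by apply/negbTE; rewrite -ltNge; near: s; exact: lt_nbhsr.
Unshelve. all: by end_near. Qed.

Lemma hlength_ge0 u : 0 <= hlength G 0 1 u.
Proof. by apply: Rintegral_ge0 => t _; exact: speed_ge0. Qed.

(** The fields are bounded only on bounded sets, so the estimate runs inside the ball of radius [r],
    where the velocity is at most [S] times the speed. Reaching the sphere would give r <= S *
    length, against [lam = r / (S + 1)]. *)
Lemma short_curve (r : R) : 0 < r -> exists2 lam : R, 0 < lam &
  forall g u, horizontal G 0 1 g u -> g 0 = 0 -> hlength G 0 1 u < lam -> `|g 1| < r.
Proof.
move=> r0.
have /choice[C CP] : forall j, exists C : R, 0 <= C /\ forall x, `|x| <= r -> `|X j x| <= C.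
  move=> j; have [K K0 KP] := smooth_lipschitz_on_ball r (smooth_cg_field G j).
  exists (K * r + `|X j 0|); split; first by rewrite addr_ge0// mulr_ge0// ltW.
  move=> x xr; rewrite -[X j x](subrK (X j 0)); apply: le_trans (ler_normD _ _) _.
  rewrite lerD2r; apply: le_trans (KP _ _ xr _) _; first by rewrite normr0 ltW.
  by rewrite subr0 ler_wpM2l.
pose S := \sum_(j < n) C j.
have S0 : 0 <= S by apply: sumr_ge0 => j _; case: (CP j).
have S1 : 0 < S + 1 by rewrite ltr_wpDl.
exists (r / (S + 1)); first exact: divr_gt0.
move=> g u hg g0; rewrite ltr_pdivlMr// => len; rewrite ltNge; apply/negP => r1.
have [gac ui gd] := hg.
(* Follow the curve up to the first time [tau] at which it leaves the ball. *)
pose A := [set t : R | 0 <= t <= 1 /\ r <= `|g t|].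
have A1 : A 1 by split=> //; rewrite ler01 lexx.
have Alb : lbound A 0 by move=> t [/andP[]].
have hA : has_inf A by split; [exists 1|exists 0].
pose tau := inf A.
have tau0 : 0 <= tau by apply: lb_le_inf => //; exists 1.
have Atau t : A t -> tau <= t by move=> At; apply: ge_inf => //; exact: (proj2 hA).
have tau1 : tau <= 1 by exact: Atau.
have before t : 0 <= t -> t < tau -> `|g t| < r.
  move=> t0 tt; rewrite ltNge; apply/negP => rt.
  have : tau <= t by apply: Atau; split=> //; rewrite t0 (le_trans (ltW tt)).
  by rewrite leNgt tt.
have rtau : r <= `|g tau|.
  rewrite leNgt; apply/negP => gr.
  have e0 : 0 < r - `|g tau| by rewrite subr_gt0.
  have [dl dl0 dlP] := abs_continuous_increment gac e0.
  have [t At ttau] := inf_adherent dl0 hA.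
  have [t01 rt] := At; have tt := Atau t At.
  have /dlP : 0 <= t <= 1 by [].
  move=> /(_ tau); rewrite tau0 tau1 => /(_ isT).
  have -> : `|t - tau| < dl.
    by rewrite ger0_norm ?subr_ge0// ltrBlDl.
  move=> /(_ isT) H; have := ler_dist_dist (g t) (g tau).
  move: H rt; rewrite ler_norml => H rt /andP[_ H']; lra.
have sub : [set` `[0, tau]] `<=` [set` `[0, (1 : R)]].
  by move=> t /=; rewrite !in_itv/= => /andP[-> /le_trans->].
have iS := integrable_speed ui.
have iS' : mu.-integrable [set` `[0, tau]] (EFin \o (fun t => S * speed G u t)).
  apply: integrable_scale => //; exact: integrableS iS.
have := abs_continuous_le_integral tau0 (abs_continuous_sub (lexx 0) tau1 gac) iS'.
move=> /(_ (fun t _ _ => mulr_ge0 S0 (speed_ge0 G u t))) H.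
have : `|g tau - g 0| <= \int[mu]_(t in [set` `[0, tau]]) (S * speed G u t).
  apply: H; apply: (@filterS _ _ (ae_filter_ringOfSetsType mu) _ _ _ gd) => t gt tI.
  have /andP[t0 tt] : 0 < t < tau by move: tI; rewrite in_itv.
  have I : t \in `]0, 1[ by rewrite in_itv/= t0 (lt_le_trans tt).
  eexists; first exact: gt I.
  apply: le_trans (ler_norm_sum _ _ _) _; rewrite /S mulr_suml.
  rewrite [leRHS](bigID (fun j => deg j == 1%N))/=.
  apply: (@le_trans _ _ (\sum_(j < n | deg j == 1%N) C j * speed G u t)).
    apply: ler_sum => j /eqP dj; rewrite normrZ mulrC; apply: ler_pM => //.
      by apply: (CP j).2; apply: ltW; exact: before (ltW t0) tt.
    exact: control_le_speed.
  rewrite lerDl; apply: sumr_ge0 => j _; rewrite mulr_ge0 ?speed_ge0//.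
  by case: (CP j).
have iS1 : mu.-integrable [set` `[0, tau]] (EFin \o speed G u) by exact: integrableS iS.
rewrite (RintegralZl _ _ iS1)// g0 subr0 => H1.
have H2 : \int[mu]_(t in [set` `[0, tau]]) speed G u t <= hlength G 0 1 u.
  rewrite hlengthE; apply: fine_le; try exact: integrable_fin_num.
  apply: ge0_subset_integral => //.
  - exact: measurable_int iS.
  - by move=> t _; rewrite lee_fin speed_ge0.
have := le_trans rtau H1; have := ler_wpM2l S0 H2; have := hlength_ge0 u; move: len.
set ell := hlength _ _ _ _; set I := \int[mu]_(t in _) _ => *; nra.
Qed.

Definition curve_lengths x y : set R := [set L | exists g u,
  [/\ horizontal G 0 1 g u, g 0 = x, g 1 = y & L = hlength G 0 1 u]].

Lemma cc_distE x y : d x y = inf (curve_lengths x y).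
Proof. by []. Qed.

Lemma curve_lengths_ge0 x y : lbound (curve_lengths x y) 0.
Proof. by move=> _ [g [u [_ _ _ ->]]]; exact: hlength_ge0. Qed.

Lemma curve_lengths_neq0 x y : reachable x y -> curve_lengths x y !=set0.
Proof. by move=> [g [u [? ? ?]]]; exists (hlength G 0 1 u), g, u. Qed.

Lemma cc_dist_unreachable x y : ~ reachable x y -> d x y = 0.
Proof.
move=> nxy; rewrite cc_distE (_ : curve_lengths x y = set0) ?inf0//.
by apply/seteqP; split=> // L [g [u [? ? ? _]]]; apply: nxy; exists g, u.
Qed.

Lemma cc_dist_ge0 x y : 0 <= d x y.
Proof.
have [r|/cc_dist_unreachable -> //] := pselect (reachable x y).
by apply: lb_le_inf; [exact: curve_lengths_neq0|exact: curve_lengths_ge0].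
Qed.

(** Common pattern of translation, dilation and reversal. Reachability excludes the default value 0
    of the infimum on the right, for which the inequality could fail. *)
Lemma cc_dist_transfer (c : R) x y x' y' : 0 < c -> reachable x y ->
  (forall L, curve_lengths x y L -> curve_lengths x' y' (c * L)) ->
  d x' y' <= c * d x y.
Proof.
move=> c0 rxy H; rewrite -ler_pdivrMl//; apply: lb_le_inf; first exact: curve_lengths_neq0.
move=> L /H HL; rewrite ler_pdivrMl//; apply: ge_inf => //.
by exists 0; exact: curve_lengths_ge0.
Qed.

Lemma cc_dist_mul x y z : reachable y z -> d (mul x y) (mul x z) <= d y z.
Proof.
move=> ryz; rewrite -[leRHS]mul1r; apply: cc_dist_transfer => //.
move=> _ [g [u [hg g0 g1 ->]]]; rewrite mul1r.
exists (fun t => mul x (g t)), u; rewrite g0 g1.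
by split; [exact: horizontal_mul|..].
Qed.

Lemma cc_dist_dilation (t : R) x y : t != 0 -> reachable x y ->
  d (dil t x) (dil t y) <= `|t| * d x y.
Proof.
move=> t0 rxy; apply: cc_dist_transfer => //; first by rewrite normr_gt0.
move=> _ [g [u [hg g0 g1 ->]]].
exists (fun s => dil t (g s)), (fun j s => t * u j s); rewrite g0 g1.
split; [exact: horizontal_dilation|by []|by []|].
by rewrite hlength_dilation//; case: hg.
Qed.

Lemma cc_dist_sym x y : reachable x y -> d y x <= d x y.
Proof.
move=> rxy; rewrite -[leRHS]mul1r; apply: cc_dist_transfer => //.
move=> _ [g [u [hg g0 g1 ->]]]; rewrite mul1r.
exists (fun t => g (-1 * t + 1)), (fun j t => - u j (-1 * t + 1)); split.
- exact: horizontal_reverse.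
- by rewrite mulr0 add0r.
- by rewrite mulr1 addNr.
- by rewrite hlength_reverse//; case: hg.
Qed.

Lemma cc_dist_small (r : R) : 0 < r -> exists2 lam : R, 0 < lam &
  forall w, reachable 0 w -> d 0 w < lam -> `|w| < r.
Proof.
move=> /short_curve[lam lam0 lamP]; exists lam => // w rw dw.
have e0 : 0 < lam - d 0 w by rewrite subr_gt0.
have hI : has_inf (curve_lengths 0 w).
  by split; [exact: curve_lengths_neq0|exists 0; exact: curve_lengths_ge0].
have [L [g [u [hg g0 <- ->]]] Ll] := inf_adherent e0 hI.
by apply: lamP hg g0 _; move: Ll; rewrite -cc_distE addrC subrK.
Qed.

End carnot_caratheodory.

(** * Irregular points *)

Section porosity.
Context {R : realType}.
Context {M : Type} (rho : M -> M -> R).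

Lemma porous_set0 : porous rho set0.
Proof. by exists 1. Qed.

Lemma porous_sub (A B : set M) : A `<=` B -> porous rho B -> porous rho A.
Proof.
move=> AB [lam lam0 P]; exists lam => // a Aa.
have [z [z1 z2 z3]] := P a (AB _ Aa); exists z; split=> // k.
by apply/seteqP; split=> // y [yb /AB By]; rewrite -(z3 k); split.
Qed.

Lemma sigma_porous_set0 : sigma_porous rho set0.
Proof.
exists (fun=> set0); first by move=> _; exact: porous_set0.
by rewrite bigcup0.
Qed.

End porosity.

Section calculus_extras.
Context {R : realType}.

Lemma uniform_dnbhs0 (T : choiceType) (A : set T) (g : R -> T -> R) (l : R) :
  (forall e : R, 0 < e -> exists2 dl : R, 0 < dl & forall t x, t != 0 -> `|t| < dl ->
     A x -> `|g t x - l| <= e) ->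
  {uniform A, g @ (0 : R)^' --> (fun=> l)}.
Proof.
move=> H P /uniform_nbhs[E [+ EP]]; rewrite -entourage_from_ballE => -[e /= e0 eE].
have e2 : 0 < e / 2 by rewrite divr_gt0.
have [dl dl0 dlP] := H _ e2.
apply/nbhs_ballP; exists dl => //= t; rewrite -ball_normE/= sub0r normrN => tdl t0.
apply: EP => x Ax; apply: eE; rewrite /= -ball_normE/= distrC.
by apply: le_lt_trans (dlP t x t0 tdl Ax) _; rewrite ltr_pdivrMr// mulrDr mulr1 ltrDl.
Qed.

Lemma natSinv_lt (e : R) : 0 < e -> exists k : nat, k.+1%:R^-1 < e.
Proof.
by move=> e0; have [k _ kP] := near_infty_natSinv_lt (PosNum e0); exists k; exact: kP (leqnn k).
Qed.

Lemma continuous_lt (V W : normedModType R) (F : V -> W) x : continuous F ->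
  forall e : R, 0 < e ->
  exists2 dl : R, 0 < dl & forall y, `|y - x| < dl -> `|F y - F x| < e.
Proof.
move=> cF e e0; have e2 : 0 < e / 2 by rewrite divr_gt0.
have [dl dl0 dlP] := proj1 (continuous_atP F x) (cF x) _ e2.
exists dl => // y /dlP H; apply: le_lt_trans H _.
by rewrite ltr_pdivrMr// mulrDr mulr1 ltrDl.
Qed.

Lemma rat_approx (l e : R) : 0 < e -> exists q : rat, `|ratr q - l| < e.
Proof.
move=> e0; have [|q] := @rat_in_itvoo R (l - e) (l + e); first lra.
rewrite in_itv/= => /andP[q1 q2]; exists q.
by rewrite ltr_norml; apply/andP; split; lra.
Qed.

Lemma ex_rootn (s : R) k : (0 < k)%N -> 0 <= s -> exists2 r : R, 0 <= r & r ^+ k = s.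
Proof.
move=> k0 s0; exists (s `^ (k%:R^-1)); first exact: powR_ge0.
by rewrite -powR_mulrn ?powR_ge0// -powRrM mulVf ?powRr1// pnatr_eq0 -lt0n.
Qed.

End calculus_extras.

(** * Increments of a Lipschitz function and the countable decomposition *)

Section irregular_points.
Context {R : realType} {n : nat} (G : carnot_group R n).
Context (f : 'rV[R]_n -> R).
Local Notation mul := (cg_mul G).
Local Notation inv := (cg_inv G).
Local Notation deg := (cg_deg G).
Local Notation dil := (dilation G).
Local Notation d := (cc_dist G).
Local Notation e_ j := (delta_mx 0 j : 'rV[R]_n).
Implicit Types (x y z w p E : 'rV[R]_n) (t : R).

Lemma dilation0 x : dil 0 x = 0.
Proof. by apply/rowP => j; rewrite !mxE expr0n eqn0Ngt deg_gt0 mul0r. Qed.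

Lemma dilationD t x y : dil t (mul x y) = mul (dil t x) (dil t y).
Proof.
have [->|t0] := eqVneq t 0; last exact: dilation_mul.
by rewrite !dilation0 cg_mul0l.
Qed.

Lemma constant_regular x : (forall y z, f y = f z) -> regular_point G f x.
Proof.
move=> cf E l _ El.
have dq0 y t : diff_quot G f E y t = 0.
  by rewrite /diff_quot (cf _ y) subrr mul0r.
have {El}<- : 0 = l.
  apply: cvg_unique El => //.
  have -> : (fun t => diff_quot G f E x t) = (fun=> 0) by apply/funext.
  exact: cvg_cst.
apply: uniform_dnbhs0 => e e0; exists 1 => // t y _ _ _.
by rewrite dq0 subrr normr0 ltW.
Qed.

Context (reach : forall x y, reachable G x y).
Context (L : R) (L0 : 0 <= L) (fL : forall x y, `|f x - f y| <= L * d x y).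

Lemma lipschitz_increment p t w : `|f (mul p (dil t w)) - f p| <= L * (`|t| * d 0 w).
Proof.
have [->|t0] := eqVneq t 0.
  by rewrite dilation0 cg_mul0r subrr normr0 mul0r mulr0.
rewrite distrC; apply: le_trans (fL _ _) _; rewrite ler_wpM2l//.
have -> : d p (mul p (dil t w)) = d (mul p 0) (mul p (dil t w)) by rewrite cg_mul0r.
apply: le_trans (cc_dist_mul _ (reach _ _)) _; rewrite -[X in d X _](dilationr0 G t).
exact: cc_dist_dilation.
Qed.

(** Both signs of [e_ j] are required: when [deg j] is even, no real dilation factor reverses the
    sign of the coordinate. *)
Lemma coord_dilation j (s : R) : exists r : R, [/\ 0 <= r, r ^+ deg j = `|s| &
  dil r (- e_ j) = s *: e_ j \/ dil r (e_ j) = s *: e_ j].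
Proof.
have [r r0 rs] := ex_rootn (deg_gt0 G j) (normr_ge0 s).
exists r; split=> //.
have E : dil r (e_ j) = `|s| *: e_ j.
  apply/rowP => i; rewrite !mxE eqxx/=; have [->|] := eqVneq i j; first by rewrite rs.
  by rewrite !mulr0.
have [s0|s0] := leP 0 s; [right|left].
  by rewrite E ger0_norm.
by rewrite -scaleN1r dilationZ E scaleN1r ltr0_norm// scaleNr opprK.
Qed.

(* Right multiplication by a multiple of [e_k] removes the first nonzero
   coordinate of [w]; by homogeneity that factor costs [o(1) |t|]. *)
Lemma lipschitz_modulus_aux m k : (n <= k + m)%N -> forall eta : R, 0 < eta ->
  exists2 r : R, 0 < r & forall w, `|w| < r ->
    (forall i : 'I_n, (i < k)%N -> w 0 i = 0) ->
    forall p t, `|f (mul p (dil t w)) - f p| <= eta * `|t|.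
Proof.
elim: m k => [|m IH] k nk eta eta0.
  exists 1 => // w _ w0 p t.
  have -> : w = 0.
    apply/rowP => i; rewrite mxE w0//; rewrite addn0 in nk.
    exact: leq_trans (ltn_ord i) nk.
  by rewrite dilationr0 cg_mul0r subrr normr0 mulr_ge0// ltW.
have [kn|kn] := leqP n k; first by apply: IH => //; rewrite (leq_trans kn)// leq_addr.
pose j := Ordinal kn.
have eta2 : 0 < eta / 2 by rewrite divr_gt0.
have [|r r0 rP] := IH k.+1 _ _ eta2; first by rewrite addSnnS.
(* Inverses appear because [w] will be recovered from [w'] by undoing the multiplication by
   [dil s (e_ j)] or [dil s (- e_ j)]. With s <= sg, this factor costs at most L * s * D * |t| <=
   eta / 2 * |t|. *)
pose D := d 0 (inv (- e_ j)) + d 0 (inv (e_ j)).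
have D0 : 0 <= D by rewrite addr_ge0// cc_dist_ge0.
pose sg := eta / 2 / (L * D + 1).
have LD1 : 0 < L * D + 1 by rewrite ltr_wpDl// mulr_ge0.
have sg0 : 0 < sg by rewrite divr_gt0.
have [r1 r10 r1P] : exists2 r1 : R, 0 < r1 &
    forall w, `|w| < r1 -> `|mul w (- w 0 j *: e_ j)| < r.
  have [r1 r10 r1P] := continuous_lt ((0, 0) : 'rV[R]_n * 'rV[R]_n) (smooth_continuous (cg_mul_smooth G)) r0.
  exists r1 => // w wr1.
  have aux (a b : 'rV[R]_n) : b = 0 -> `|a - b| < r -> `|a| < r by move=> ->; rewrite subr0.
  apply: (aux _ _ (cg_mul0r G 0)); apply: (r1P (w, - w 0 j *: e_ j)).
  have -> : (w, - w 0 j *: e_ j) - (0, 0) = (w, - w 0 j *: e_ j) by exact: subr0.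
  rewrite prod_normE/= gt_max wr1/=.
  apply: le_lt_trans wr1; apply: rV_norm_le => // i; rewrite !mxE eqxx/=.
  have [_|_] := eqVneq i j; last by rewrite mulr0 normr0.
  by rewrite mulr1 normrN rV_coord_le.
exists (Num.min r1 (sg ^+ deg j)); first by rewrite lt_min r10 exprn_gt0.
move=> w; rewrite lt_min => /andP[wr1 wsg] w0 p t.
pose w' := mul w (- w 0 j *: e_ j).
(* By [cg_deg_homo] such an [i] has degree at most [deg j], so the factor along [e_ j] has no
   coordinate of degree below [deg i]. Hence [cg_mul_coord] simply adds coordinates: the one at [j]
   cancels and the earlier ones stay 0. *)
have w'0 (i : 'I_n) : (i < k.+1)%N -> w' 0 i = 0.
  rewrite ltnS => ik; rewrite cg_mul_coord => [|l li].
    rewrite !mxE eqxx/=; move: ik; rewrite leq_eqVlt => /orP[/eqP ij|ik].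
      have -> : i = j by exact: val_inj.
      by rewrite eqxx mulr1 subrr.
    rewrite w0// add0r (_ : i == j = false) ?mulr0//.
    by apply/negbTE/eqP => ij; move: ik; rewrite ij ltnn.
  rewrite !mxE eqxx/= (_ : l == j = false) ?mulr0//.
  apply/negbTE/eqP => lj; move: li; rewrite lj ltnNge.
  by rewrite (@cg_deg_homo _ _ G i j).
have H1 := rP w' (r1P w wr1) w'0 p t.
have [s [s0 sd sE]] := coord_dilation j (- w 0 j).
have ssg : s <= sg.
  have sgd : s ^+ deg j <= sg ^+ deg j.
    by rewrite sd normrN; apply: le_trans (rV_coord_le _ _) (ltW wsg).
  by rewrite -(@ler_pXn2r _ (deg j)) ?deg_gt0// nnegrE// ltW.
have [v vD wE] : exists2 v, d 0 v <= D & w = mul w' (dil s v).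
  case: sE => sE.
    exists (inv (- e_ j)); first by rewrite lerDl cc_dist_ge0.
    by rewrite /w' -sE -cg_mulA -dilationD cg_mulVr dilationr0 cg_mul0r.
  exists (inv (e_ j)); first by rewrite lerDr cc_dist_ge0.
  by rewrite /w' -sE -cg_mulA -dilationD cg_mulVr dilationr0 cg_mul0r.
have H2 : `|f (mul p (dil t w)) - f (mul p (dil t w'))| <= eta / 2 * `|t|.
  rewrite {1}wE dilationD cg_mulA dilationM; apply: le_trans (lipschitz_increment _ _ _) _.
  rewrite normrM (ger0_norm s0).
  have E1 : s * (L * D + 1) <= eta / 2 by rewrite -ler_pdivlMr.
  have E2 : L * d 0 v <= L * D by rewrite ler_wpM2l.
  have -> : L * (`|t| * s * d 0 v) = s * (L * d 0 v) * `|t| by ring.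
  rewrite ler_wpM2r//; apply: le_trans E1; rewrite ler_wpM2l//.
  by rewrite (le_trans E2)// lerDl.
have -> : f (mul p (dil t w)) - f p =
  (f (mul p (dil t w)) - f (mul p (dil t w'))) + (f (mul p (dil t w')) - f p).
  by rewrite addrA subrK.
apply: le_trans (ler_normD _ _) _; rewrite (splitr eta) mulrDl.
exact: lerD.
Qed.

Lemma lipschitz_modulus (eta : R) : 0 < eta -> exists2 r : R, 0 < r & forall w, `|w| < r ->
  forall p t, `|f (mul p (dil t w)) - f p| <= eta * `|t|.
Proof.
move=> eta0; have [r r0 rP] := @lipschitz_modulus_aux n 0 (leqnn n) eta eta0.
by exists r => // w wr; exact: rP.
Qed.

(* [dil t E] is [t *: E] for [E] in [V_1]; with [dil] the estimates below make
   sense for all [E], in particular for rational approximations. *)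
Definition nonuniform_at E (l eps dl : R) : set 'rV[R]_n := [set x |
  (forall t, t != 0 -> `|t| < dl ->
     `|f (mul x (dil t E)) - f x - t * l| <= eps / 4 * `|t|) /\
  (forall r : R, 0 < r -> exists t u, [/\ t != 0, `|t| < r, d u 0 <= 1 &
     eps / 2 * `|t| < `|f (mul (mul x (dil t u)) (dil t E)) - f (mul x (dil t u)) - t * l|])].

Lemma dilation_shift z w E t :
  mul (mul z (dil t w)) (dil t E) = mul (mul z (dil t E)) (dil t (mul (inv E) (mul w E))).
Proof.
rewrite -!cg_mulA -!dilationD; congr (mul z (dil t _)).
by rewrite cg_mulA cg_mulVr cg_mul0l.
Qed.

(** If [y] in the set were too close to z, the estimate eps/4 at [y] and two errors eps/16, one at
    the base point and one at the endpoint, would give at most 3 eps/8 at z, below the eps/2 that z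
    violates. *)
Lemma porous_nonuniform_at E (l eps dl : R) : 0 < eps -> 0 < dl ->
  porous d (nonuniform_at E l eps dl).
Proof.
move=> eps0 dl0.
have eta0 : 0 < eps / 16 by rewrite divr_gt0.
have [r r0 rP] := lipschitz_modulus eta0.
have cF : continuous (fun w : 'rV[R]_n => mul (inv E) (mul w E)).
  move=> w; apply: (@continuous_comp _ _ _ (fun w => mul w E) (mul (inv E))).
    exact: (smooth_continuous (smooth_pairl E (cg_mul_smooth G))).
  exact: (smooth_continuous (smooth_mull G (inv E))).
have [r1 r10] := continuous_lt 0 cF r0; rewrite cg_mul0l cg_mulVl => r1P.
(* [r] makes [w] itself harmless and [r1] its conjugate by [E]; the resulting [lam] is the porosity
   constant, the same at all points of the set. *)
have [|lam lam0 lamP] := @cc_dist_small _ _ G (Num.min r r1); first by rewrite lt_min r0.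
exists lam => // x [x1 x2].
have /choice[t /choice[u tuP]] : forall k : nat, exists t u,
    [/\ t != 0, `|t| < Num.min dl k.+1%:R^-1, d u 0 <= 1 &
     eps / 2 * `|t| < `|f (mul (mul x (dil t u)) (dil t E)) - f (mul x (dil t u)) - t * l|].
  by move=> k; apply: x2; rewrite lt_min dl0 invr_gt0 ltr0n.
exists (fun k => mul x (dil (t k) (u k))).
have du (s : R) v : s != 0 -> d v 0 <= 1 -> d (mul x (dil s v)) x <= `|s|.
  move=> s0 dv; rewrite -[X in d _ X](cg_mul0r G x).
  apply: le_trans (cc_dist_mul _ (reach _ _)) _; rewrite -[X in d _ X](dilationr0 G s).
  by apply: le_trans (cc_dist_dilation s0 (reach _ _)) _; rewrite ler_piMr.
split.
- apply/cvgrPdist_le => e e0; have [K KP] := natSinv_lt e0.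
  exists K => // k /= Kk; rewrite sub0r normrN ger0_norm ?cc_dist_ge0//.
  have [t0 tk uk _] := tuP k; apply: le_trans (du _ _ t0 uk) _.
  move: tk; rewrite lt_min => /andP[_ tk]; apply/ltW/(lt_trans tk)/le_lt_trans/KP.
  by rewrite lef_pV2 ?posrE ?ltr0n// ler_nat.
(* If z were [x], the bound eps/4 at [x] would contradict the failure of the bound eps/2 at z. *)
- move=> k zx; have [t0 tk uk] := tuP k; rewrite zx ltNge => /negP; apply.
  move: tk; rewrite lt_min => /andP[tk _]; apply: le_trans (x1 _ t0 tk) _.
  by rewrite ler_wpM2r//; lra.
move=> k; apply/seteqP; split=> // y [/= yz [y1 _]].
have [t0 tk uk] := tuP k; move: (t k) (u k) t0 tk uk yz => {t u tuP} t u t0 tk uk.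
set z := mul x (dil t u) => yz; rewrite ltNge => /negP; apply.
have tn0 : 0 < `|t| by rewrite normr_gt0.
pose w := dil t^-1 (mul (inv z) y).
have yE : y = mul z (dil t w) by rewrite dilationVK// cg_mulA cg_mulVr cg_mul0l.
have dw : d 0 w < lam.
  rewrite -[X in d X _](dilationr0 G t^-1).
  apply: le_lt_trans (cc_dist_dilation _ (reach _ _)) _; first by rewrite invr_eq0.
  rewrite normfV ltr_pdivrMl//.
  rewrite -[X in d X _](cg_mulVl G z).
  apply: le_lt_trans (cc_dist_mul _ (reach _ _)) _.
  apply: lt_le_trans yz _; rewrite mulrC ler_wpM2r//; first exact: ltW.
  by apply: le_trans (cc_dist_sym (reach _ _)) _; exact: du.
have := lamP w (reach _ _) dw; rewrite lt_min => /andP[wr wr1].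
have H1 := rP w wr z t; rewrite -yE in H1.
have := r1P w; rewrite !subr0 => /(_ wr1) wr2.
have H2 := rP _ wr2 (mul z (dil t E)) t; rewrite -dilation_shift -yE in H2.
move: tk; rewrite lt_min => /andP[tk _].
have H3 := y1 t t0 tk.
move: H1 H2 H3; set a := f (mul z _); set b := f z; set a' := f (mul y _); set b' := f y.
rewrite !ler_norml => /andP[? ?] /andP[? ?] /andP[? ?]; apply/andP; split; lra.
Qed.

Lemma diff_quot_dist E y t (l : R) : t != 0 -> in_V1 G E ->
  `|diff_quot G f E y t - l| * `|t| = `|f (mul y (dil t E)) - f y - t * l|.
Proof.
move=> t0 EV; rewrite -normrM /diff_quot dilation_V1//.
by rewrite mulrBl divfK// (mulrC l).
Qed.

(** Replacing [E] and [l] by rational data costs eps/16 each. At [x] the derivative estimate eps/16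
    becomes 3 eps/16 <= eps/4, and at the bad points a failure by more than eps remains one by more
    than 7 eps/8 >= eps/2. *)
Lemma irregular_nonuniform x : ~ regular_point G f x ->
  exists (E : 'rV[rat]_n) (l : rat) (k m : nat),
    nonuniform_at (map_mx ratr E) (ratr l) k.+1%:R^-1 m.+1%:R^-1 x.
Proof.
move=> /existsNP[E /existsNP[l /not_implyP[EV /not_implyP[El]]]] nu.
have [e e0 eP] : exists2 e : R, 0 < e & forall r : R, 0 < r -> exists t u,
    [/\ t != 0, `|t| < r, d u 0 <= 1 &
    e < `|diff_quot G f E (mul x (dil t u)) t - l| ].
  apply: contrapT => ne; apply: nu; apply: uniform_dnbhs0 => e e0.
  apply: contrapT => nr; apply: ne; exists e => // r r0.
  apply: contrapT => nt; apply: nr; exists r => // t u t0 tr /= du.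
  by rewrite leNgt; apply/negP => eD; apply: nt; exists t, u.
have [k ke] := natSinv_lt e0; set eps : R := k.+1%:R^-1 in ke.
have eps0 : 0 < eps by rewrite invr_gt0 ltr0n.
have eta0 : 0 < eps / 16 by rewrite divr_gt0.
have [r r0 rP] := lipschitz_modulus eta0.
(* Closeness of E' to [E] is measured by E^-1 E', since the endpoint of the increment along E' is
   that along [E] multiplied by [dil t] of this element. *)
have [r1 r10] := continuous_lt E (smooth_continuous (smooth_mull G (inv E))) r0.
rewrite cg_mulVl => r1P.
have r12 : 0 < r1 / 2 by rewrite divr_gt0.
have /choice[q qP] := fun j => rat_approx (E 0 j) r12.
pose E' : 'rV[rat]_n := \row_j q j.
have E'E : `|map_mx ratr E' - E| < r1.
  apply: (@le_lt_trans _ _ (r1 / 2)).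
    apply: rV_norm_le => [|j]; first exact: ltW.
    by rewrite !mxE; exact/ltW/qP.
  by rewrite ltr_pdivrMr// mulrDr mulr1 ltrDl.
have [l' l'l] := rat_approx l eta0.
have /cvg_dnbhs0P/(_ _ eta0)[dl dl0 dlP] := El.
have [m mdl] := natSinv_lt dl0.
exists E', l', k, m.
have step y t : `|f (mul y (dil t (map_mx ratr E'))) - f (mul y (dil t E))| <= eps / 16 * `|t|.
  have -> : mul y (dil t (map_mx ratr E')) =
      mul (mul y (dil t E)) (dil t (mul (inv E) (map_mx ratr E'))).
    by rewrite -cg_mulA -dilationD cg_mulA cg_mulVr cg_mul0l.
  by apply: rP; have := r1P _ E'E; rewrite subr0.
have lstep t : `|t * ratr l' - t * l| <= eps / 16 * `|t|.
  by rewrite -mulrBr normrM mulrC ler_wpM2r// ltW.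
split=> [t t0 tm|s s0].
  have H := dlP t t0 (lt_trans tm mdl).
  have := ler_wpM2r (normr_ge0 t) H; rewrite diff_quot_dist//.
  move: (step x t) (lstep t); move: (f (mul x (dil t (map_mx ratr E')))) => a.
  move: (f (mul x (dil t E))) (f x) (t * ratr l') (t * l) => b c u v.
  have := normr_ge0 t; rewrite -/eps.
  rewrite !ler_norml => ? /andP[? ?] /andP[? ?] /andP[? ?]; apply/andP; split; nra.
have [t [u [t0 ts du eD]]] := eP s s0; exists t, u; split=> //.
have tn0 : 0 < `|t| by rewrite normr_gt0.
have H : eps * `|t| < `|diff_quot G f E (mul x (dil t u)) t - l| * `|t|.
  by rewrite ltr_pM2r// (lt_trans ke).
rewrite diff_quot_dist// in H.
move: H (step (mul x (dil t u)) t) (lstep t).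
move: (f (mul (mul x (dil t u)) (dil t (map_mx ratr E')))) => a.
move: (f (mul (mul x (dil t u)) (dil t E))) (f (mul x (dil t u))) (t * ratr l') (t * l) => b c v v'.
rewrite -/eps => H; rewrite ltNge => h1 h2; apply/negP => h3.
move: H; rewrite ltNge => /negP; apply.
move: h1 h2 h3; rewrite !ler_norml => /andP[? ?] /andP[? ?] /andP[? ?]; apply/andP; split; nra.
Qed.

Lemma sigma_porous_irregular : sigma_porous d [set x | ~ regular_point G f x].
Proof.
pose A (i : 'rV[rat]_n * rat * nat * nat) : set 'rV[R]_n :=
  nonuniform_at (map_mx ratr i.1.1.1) (ratr i.1.1.2) i.1.2.+1%:R^-1 i.2.+1%:R^-1.
(* The rational data form a countable type. A piece [A i] may contain regular points, so it is cut
   down to the irregular set to make the union an equality. *)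
exists (fun N => if @unpickle ('rV[rat]_n * rat * nat * nat)%type N is Some i
  then A i `&` [set x | ~ regular_point G f x] else set0).
  move=> N; case: unpickle => [i|]; last exact: porous_set0.
  apply: porous_sub (@subIsetl _ _ _) _; apply: porous_nonuniform_at.
  - by rewrite invr_gt0 ltr0n.
  - by rewrite invr_gt0 ltr0n.
apply/seteqP; split=> x.
  move=> nx; have [E [l [k [m AP]]]] := irregular_nonuniform nx.
  exists (pickle (E, l, k, m)); first by [].
  by rewrite pickleK; split; [exact: AP|exact: nx].
by move=> [N _]; case: unpickle => [i [_]|//].
Qed.

End irregular_points.

Theorem proposition4p3 (R : realType) (n : nat) (G : carnot_group R n)
    (f : 'rV[R]_n -> R) (hf : dist_lipschitz (cc_dist G) f) :
  sigma_porous (cc_dist G) [set x | ~ regular_point G f x].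
Proof.
have [L fL] := hf.
have [reach|/existsNP[x0 /existsNP[y0 nr]]] :=
    pselect (forall x y, reachable G x y).
  (* The Lipschitz constant in [dist_lipschitz] may be any real, so its absolute value is used. *)
  apply: (sigma_porous_irregular reach (normr_ge0 L)) => x y.
  by apply: le_trans (fL x y) _; rewrite ler_wpM2r ?cc_dist_ge0// ler_norm.
(* The junk value [inf set0 = 0] of the distance forces [f] to be constant. *)
have feq x y : ~ reachable G x y -> f x = f y.
  move=> /cc_dist_unreachable dxy; have := fL x y; rewrite dxy mulr0 normr_le0.
  by rewrite subr_eq0 => /eqP.
(* A point z reachable from [x0] cannot reach [y0], by transitivity; then f z = f y0 = f x0. *)
have fx0 z : f z = f x0.
  have [r|/feq//] := pselect (reachable G x0 z).
  rewrite (feq _ _ nr); apply: feq => r'; apply: nr; exact: reachable_trans r r'.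
rewrite (_ : [set x | _] = set0); first exact: sigma_porous_set0.
by apply/seteqP; split=> // x /=; apply; apply: constant_regular => y z; rewrite !fx0.
Qed.
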